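(* There exist nonempty open sets $O_1,O_2\subset\{(\epsilon_X,\epsilon_Y)\in(-1,1)^2:\epsilon_X\neq\epsilon_Y\}$ such that for $(\epsilon_X,\epsilon_Y)\in O_1$ the cycle $C_1$, and for $(\epsilon_X,\epsilon_Y)\in O_2$ the cycle $C_2$, of the Rock-Scissors-Paper replicator system is neither almost completely unstable nor essentially asymptotically stable. Moreover, for $(\epsilon_X,\epsilon_Y)\in O_1$ (respectively $O_2$) there exists a nonempty open set of points of the phase space which is attracted to $C_1$ (respectively $C_2$), i.e. whose $\omega$-limit sets are contained in $C_1$ (respectively $C_2$).
   Context: System. For $\epsilon\in(-1,1)$ let $M(\epsilon)$ be the $3\times 3$ matrix with rows $(\tfrac23\epsilon,\,1-\tfrac13\epsilon,\,-1-\tfrac13\epsilon)$, $(-1-\tfrac13\epsilon,\,\tfrac23\epsilon,\,1-\tfrac13\epsilon)$, $(1-\tfrac13\epsilon,\,-1-\tfrac13\epsilon,\,\tfrac23\epsilon)$. Put $A=M(\epsilon_X)$, $B=M(\epsilon_Y)$. The system is $\dot x_i=x_i[(Ay)_i-x^TAy]$, $\dot y_j=y_j[(Bx)_j-y^TBx]$, $i,j=1,2,3$, with $x_i,y_j\ge 0$, $x_1+x_2+x_3=1$, $y_1+y_2+y_3=1$. Eliminating $x_3=1-x_1-x_2$ and $y_3=1-y_1-y_2$, the state space (phase space) is $\Delta=\{(x_1,x_2,y_1,y_2): x_1,x_2\ge0,\ x_1+x_2\le1,\ y_1,y_2\ge0,\ y_1+y_2\le 1\}\subset\mathbb R^4$;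 $\phi_t$ denotes the flow on $\Delta$ and $\omega(p)$ the $\omega$-limit set. Cycles. Put $R=(1,0)$, $S=(0,1)$, $P=(0,0)$; the nine points $(V,U)$, $V,U\in\{R,S,P\}$, are equilibria. $C_1$ is the set consisting of the equilibria in $(P,P)\to(S,P)\to(S,S)\to(R,S)\to(R,R)\to(P,R)\to(P,P)$ and the open straight segments joining consecutive ones; $C_2$ is the set consisting of the equilibria in $(P,P)\to(P,S)\to(S,S)\to(S,R)\to(R,R)\to(R,P)\to(P,P)$ and the open straight segments joining consecutive ones. Each segment is a heteroclinic orbit in the indicated direction. Stability. A compact invariant set $X$ is asymptotically stable relative to $N$ if for every neighbourhood $U$ of $X$ there is a neighbourhood $V$ of $X$ such that for all $p\in V\cap N$ we have $\omega(p)\subset X$ and $\phi_t(p)\in U\cap N$ for all $t>0$. It is completely unstable relative to $N$ if there is a neighbourhood $U$ of $X$ such that for all $p\in U\cap N$ there is $t_0>0$ with $\phi_{t_0}(p)\notin U$. $X$ is essentially asymptotically stable (respectively almost completely unstable) if it is asymptotically stable (respectively completely unstable) relative to some set $N$ with $\lim_{\epsilon\to0}\mathcal L(\{p: \mathrm{dist}(p,X)<\epsilon\}\cap N)/\mathcal L(\{p:\mathrm{dist}(p,X)<\epsilon\})=1$. Here $\mathcal L$ is 4-dimensional Lebesgue measure and all points $p$ and neighbourhoods are taken in $\Delta$. *)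

(* Defs.v *)
From HB Require Import structures.
From mathcomp Require Import all_boot all_order all_algebra.
From mathcomp Require Import all_classical all_reals all_analysis.

Set Implicit Arguments.
Unset Strict Implicit.
Unset Printing Implicit Defensive.
Import Order.TTheory GRing.Theory Num.Theory.
Import numFieldNormedType.Exports.
Local Open Scope classical_set_scope.
Local Open Scope ring_scope.

(* (x1, x2, y1, y2); the coordinates x3 = 1 - x1 - x2, y3 = 1 - y1 - y2 are
   eliminated. *)
Notation state R := (R * R * R * R)%type.

Section Replicator.
Context {R : realType}.

Definition rsp_mx (e : R) : 'M[R]_3 :=
  \matrix_(i < 3, j < 3) nth 0 (nth [::]
    [:: [:: 2 / 3 * e;       1 - 1 / 3 * e;   - 1 - 1 / 3 * e];
        [:: - 1 - 1 / 3 * e; 2 / 3 * e;       1 - 1 / 3 * e];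
        [:: 1 - 1 / 3 * e;   - 1 - 1 / 3 * e; 2 / 3 * e]] i) j.

Definition mixed (a b : R) : 'cV[R]_3 :=
  \col_(i < 3) nth 0 [:: a; b; 1 - a - b] i.

Definition replicator (M : 'M[R]_3) (x y : 'cV[R]_3) (i : 'I_3) : R :=
  x i 0 * ((M *m y) i 0 - (x^T *m M *m y) 0 0).

(* The two equations for x3 and y3 follow from the four kept here, since the
   replicator components sum to zero on the simplex. *)
Definition rsp_field (eX eY : R) (p : state R) : state R :=
  let: (x1, x2, y1, y2) := p in
  let x := mixed x1 x2 in let y := mixed y1 y2 in
  let A := rsp_mx eX in let B := rsp_mx eY in
  (replicator A x y 0, replicator A x y 1,
   replicator B y x 0, replicator B y x 1).

Definition Delta : set (state R) :=
  [set p | let: (x1, x2, y1, y2) := p in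
           [/\ 0 <= x1, 0 <= x2 & x1 + x2 <= 1] /\
           [/\ 0 <= y1, 0 <= y2 & y1 + y2 <= 1]].

(* The values of phi outside Delta are irrelevant. On the compact invariant
   set Delta the flow exists for all times and is unique. *)
Definition rsp_flow (eX eY : R) (phi : R -> state R -> state R) : Prop :=
  forall p, Delta p ->
    phi 0 p = p /\
    forall t, Delta (phi t p) /\
      is_derive t 1 (phi^~ p) (rsp_field eX eY (phi t p)).

Definition omega_limit (phi : R -> state R -> state R) (p : state R) :
  set (state R) := cluster (phi^~ p @ +oo).

Definition Rk : R * R := (1, 0).
Definition Sc : R * R := (0, 1).
Definition Pa : R * R := (0, 0).
Definition vertex (V U : R * R) : state R := (V.1, V.2, U.1, U.2).

(* The vertices of the cyclic sequence c together with the open segments from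
   each vertex to its cyclic successor. *)
Definition cycle_of (c : seq (state R)) : set (state R) :=
  [set` c] `|`
  [set q | exists2 p, p \in c &
     exists2 s : R, 0 < s < 1 & q = (1 - s) *: p + s *: next c p].

Definition C1 : set (state R) :=
  cycle_of [:: vertex Pa Pa; vertex Sc Pa; vertex Sc Sc;
               vertex Rk Sc; vertex Rk Rk; vertex Pa Rk].

Definition C2 : set (state R) :=
  cycle_of [:: vertex Pa Pa; vertex Pa Sc; vertex Sc Sc;
               vertex Sc Rk; vertex Rk Rk; vertex Rk Pa].

(* The norm of the product space R * R * R * R is the maximum norm, hence the
   explicit Euclidean distance. *)
Definition eucl_dist (p q : state R) : R :=
  let: (x1, x2, y1, y2) := p in
  let: (x1', x2', y1', y2') := q in
  Num.sqrt ((x1 - x1') ^+ 2 + (x2 - x2') ^+ 2 +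
            (y1 - y1') ^+ 2 + (y2 - y2') ^+ 2).

Definition set_dist (p : state R) (X : set (state R)) : R :=
  inf [set eucl_dist p q | q in X].

Definition tube (X : set (state R)) (e : R) : set (state R) :=
  [set p | Delta p /\ set_dist p X < e].

Definition borel_leb4 : {measure set (state (measurableTypeR R)) -> \bar R} :=
  (@lebesgue_measure R \x @lebesgue_measure R \x @lebesgue_measure R
     \x @lebesgue_measure R)%E.

(* borel_leb4 is meaningful on Borel sets only; its outer extension, restricted
   to the Caratheodory measurable sets, is the (complete) Lebesgue measure. *)
Definition leb4 : {outer_measure set (state (measurableTypeR R)) -> \bar R} :=
  (borel_leb4^*)%mu.

Definition full_density (X N : set (state R)) : Prop :=
  leb4.-caratheodory N /\
  fine (leb4 (tube X e `&` N)) / fine (leb4 (tube X e)) @[e --> 0^'+] -->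
    (1 : R).

(* Neighbourhoods in the topology of the phase space. *)
Definition nbhd (X U : set (state R)) : Prop :=
  exists2 W, set_nbhs X W & U = W `&` Delta.

Definition asymptotically_stable_rel (phi : R -> state R -> state R)
    (X N : set (state R)) : Prop :=
  forall U, nbhd X U -> exists2 V, nbhd X V &
    forall p, (V `&` N) p ->
      omega_limit phi p `<=` X /\ forall t, 0 < t -> (U `&` N) (phi t p).

Definition completely_unstable_rel (phi : R -> state R -> state R)
    (X N : set (state R)) : Prop :=
  exists2 U, nbhd X U &
    forall p, (U `&` N) p -> exists2 t0, 0 < t0 & ~ U (phi t0 p).

Definition essentially_asymptotically_stable
    (phi : R -> state R -> state R) (X : set (state R)) : Prop :=
  exists2 N, full_density X N & asymptotically_stable_rel phi X N.

Definition almost_completely_unstable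
    (phi : R -> state R -> state R) (X : set (state R)) : Prop :=
  exists2 N, full_density X N & completely_unstable_rel phi X N.

(* G is open relative to Delta. *)
Definition attracts_open_set (phi : R -> state R -> state R)
    (X : set (state R)) : Prop :=
  exists G : set (state R), [/\ (exists2 W, open W & G = W `&` Delta),
    G !=set0 & forall p, G p -> omega_limit phi p `<=` X].

Definition unequal_params : set (R * R) :=
  [set e | [/\ -1 < e.1 < 1, -1 < e.2 < 1 & e.1 != e.2]].

End Replicator.

(* Main.v *)
Require Import Defs.
From HB Require Import structures.
From mathcomp Require Import all_boot all_order all_algebra.
From mathcomp Require Import all_classical all_reals all_analysis.
From mathcomp Require Import ring lra.
Import Order.TTheory GRing.Theory Num.Theory.
Import numFieldNormedType.Exports.
Local Open Scope classical_set_scope.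
Local Open Scope ring_scope.

(** Along an orbit with positive coordinates the logarithms of the quotients
    x_i / x_j have derivatives that are linear in y, and those of y_i / y_j have
    derivatives that are linear in x. Close to a cycle one strategy carries
    almost all the weight of each player most of the time, so in logarithmic
    coordinates an orbit follows a piecewise linear path up to small relative
    errors. No linearization and no smooth return map is needed: mean value
    estimates for four logarithmic ratios and first exit times suffice.

    Number the strategies R, S, P as 1, 2, 3. Consider C1 with eX close to 1/2
    and eY close to 1, and start an orbit near the edge from (P, R) to (P, P)
    with u = - ln (x2 / x3), v = - ln (x1 / x3), w = - ln (y2 / y3) large.
    While y stays near P, x passes from P to S in time about 2 u; then y leaves P
    for S. When y is half-way from P to S the configuration has been rotated,
    R -> P -> S -> R, and the new coordinates are approximately
      u' = v + 3 u + w,   v' = w / 4,   w' = 4 u - w.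
    This map sends the cone u / 4 <= w <= 2 u, u / 200 <= v <= 3 u / 2 into its
    interior and at least triples u, with enough room for the errors and for an
    open set of parameters ([cone_passage]). Hence an orbit that starts in the
    cone with u large stays close to C1 ([cone_stays]) and accumulates on C1
    only ([cone_attracted]).

    A point at distance about d from the cycle near that edge, with x1, x2, y2
    all between d / 4 and d / 2, has u, v, w equal to - ln d up to bounded terms,
    and the direction (1, 1, 1) is inside the cone. These points form a box that
    takes up a fixed positive fraction of the d-tube around the cycle, because
    both volumes are of the order of d^3; so a set of full density meets it
    for all small d. This excludes almost complete instability and gives the
    attracted open set.

    Near the edge from (P, P) to (S, P) the situation is reversed. If x1, y1, y2
    are all between d / 4 and d / 2, then once x is near S the weight y1 grows at
    the rate 2, faster than y2, whose rate is 1 + eY. When y finally leaves P,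
    the weight y1 is not small ([escape]): the orbit is drawn towards the
    connection from (S, P) to (S, R) and leaves a fixed neighbourhood of C1.
    Again such points take up a positive fraction of the tube, so C1 is not
    essentially asymptotically stable.

    Exchanging the players turns C1 into C2. The dynamical statements are
    about six coordinate functions, so they apply to both cycles, and the volume
    estimates treat all six edges alike. *)

Set Implicit Arguments.
Unset Strict Implicit.
Unset Printing Implicit Defensive.

(** The tolerance on parameters and on growth rates. It is written as a
    quotient of small numbers because numerals are unary terms. *)
Local Notation th := (1 / 10 / 10 / 10).

(** * Boxes and Lebesgue measure in the phase space *)

Section Measure.
Context {R : realType}.
Implicit Types (N B X : set (state R)).

Definition rect (I1 I2 I3 I4 : set R) : set (state R) :=
  I1 `*` I2 `*` I3 `*` I4.

Lemma rect_measurable (I1 I2 I3 I4 : set (measurableTypeR R)) :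
  measurable I1 -> measurable I2 -> measurable I3 -> measurable I4 ->
  measurable (rect I1 I2 I3 I4 : set (state (measurableTypeR R))).
Proof. by move=> *; do 3 (apply: measurableX => //). Qed.

Lemma rect_caratheodory (I1 I2 I3 I4 : set (measurableTypeR R)) :
  measurable I1 -> measurable I2 -> measurable I3 -> measurable I4 ->
  leb4.-caratheodory (rect I1 I2 I3 I4).
Proof.
move=> m1 m2 m3 m4.
by apply: caratheodory_measurable_mu_ext; exact: rect_measurable.
Qed.

(** On Borel sets the outer extension is the product measure itself. *)
Lemma leb4_rect (a1 b1 a2 b2 a3 b3 a4 b4 : R) :
  a1 <= b1 -> a2 <= b2 -> a3 <= b3 -> a4 <= b4 ->
  leb4 (rect `[a1, b1] `[a2, b2] `[a3, b3] `[a4, b4]) =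
    ((b1 - a1) * (b2 - a2) * (b3 - a3) * (b4 - a4))%:E.
Proof.
move=> h1 h2 h3 h4.
have itvE (a b : R) : a <= b ->
    @lebesgue_measure R `[a, b] = (b - a)%:E.
  move=> ab; rewrite lebesgue_measure_itv /= lte_fin.
  by move: ab; rewrite le_eqVlt => /predU1P[->|->//]; rewrite ltxx subrr.
rewrite /leb4 /= measurable_mu_extE; last first.
  by apply: rect_measurable; exact: measurable_itv.
pose l := (@lebesgue_measure R : {sigma_finite_measure set (measurableTypeR R) -> \bar R}).
have step d (T : measurableType d) (m : {measure set T -> \bar R}) (A : set T) (a b : R) :
    measurable A -> a <= b -> 
    (m \x l)%E (A `*` `[a, b]) = (m A * (b - a)%:E)%E.
  move=> mA ab; rewrite product_measure1E //; first by congr (_ * _)%E; exact: itvE.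
rewrite /borel_leb4 /rect.
have E1 : ((l \x l) (`[a1, b1] `*` `[a2, b2]))%E = ((b1 - a1) * (b2 - a2))%:E.
  by rewrite step // EFinM; congr (_ * _)%E; exact: itvE.
have E2 : ((l \x l \x l) (`[a1, b1] `*` `[a2, b2] `*` `[a3, b3]))%E = ((b1 - a1) * (b2 - a2) * (b3 - a3))%:E.
  apply: etrans; first by apply: step => //; apply: measurableX.
  by rewrite [in RHS]EFinM; congr (_ * _)%E; exact: E1.
apply: etrans; first by apply: step => //; apply: measurableX => //; apply: measurableX.
by rewrite [in RHS]EFinM; congr (_ * _)%E; exact: E2.
Qed.

(** If N missed B e, then N would miss a proportion of at least k / C of the
    tube for arbitrarily small e, and its density could not tend to 1. *)
Lemma full_density_meets X N (B : R -> set (state R)) (k C : R) :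
  0 < k ->
  (\forall e \near 0^'+, [/\ leb4.-caratheodory (B e), B e `<=` tube X e,
     ((k * e ^+ 3)%:E <= leb4 (B e))%E & (leb4 (tube X e) <= (C * e ^+ 3)%:E)%E]) ->
  full_density X N -> \forall e \near 0^'+, (N `&` B e) !=set0.
Proof.
move=> k0 hB [_ /cvgrPdist_lt dens].
have C0 : 0 < C.
  near (0:R)^'+ => e.
  have [_ /(le_outer_measure leb4) BT kB TC] :
    [/\ leb4.-caratheodory (B e), B e `<=` tube X e,
     ((k * e ^+ 3)%:E <= leb4 (B e))%E & (leb4 (tube X e) <= (C * e ^+ 3)%:E)%E]
    by near: e.
  have e0 : 0 < e by near: e; exact: nbhs_right_gt.
  have := le_trans kB (le_trans BT TC); rewrite lee_fin ler_pM2r ?exprn_gt0 //.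
  exact: lt_le_trans.
near=> e.
have [BM BT kB TC]: [/\ leb4.-caratheodory (B e), B e `<=` tube X e,
     ((k * e ^+ 3)%:E <= leb4 (B e))%E & (leb4 (tube X e) <= (C * e ^+ 3)%:E)%E]
    by near: e.
have e0 : 0 < e by near: e; exact: nbhs_right_gt.
apply: contrapT => /set0P/negP/negPn/eqP NB.
have : `|1 - fine (leb4 (tube X e `&` N)) / fine (leb4 (tube X e))| < k / C.
  by near: e; apply: dens; rewrite divr_gt0.
apply/negP; rewrite -leNgt.
have fT : leb4 (tube X e) \is a fin_num.
  by rewrite ge0_fin_numE ?outer_measure_ge0 //; exact: le_lt_trans TC (ltry _).
have fB : leb4 (B e) \is a fin_num.
  rewrite ge0_fin_numE ?outer_measure_ge0 //.
  apply: le_lt_trans (ltry (fine (leb4 (tube X e)))).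
  by rewrite fineK //; exact: le_outer_measure.
have TNT : tube X e `&` N `<=` tube X e `&` ~` B e.
  move=> p [Tp Np]; split=> // Bp.
  by have : (N `&` B e) p by []; rewrite NB.
have fN : leb4 (tube X e `&` N) \is a fin_num.
  rewrite ge0_fin_numE ?outer_measure_ge0 //.
  apply: le_lt_trans (ltry (fine (leb4 (tube X e)))).
  by rewrite fineK //; apply: le_outer_measure; exact: subIsetl.
have : (leb4 (tube X e `&` N) + leb4 (B e) <= leb4 (tube X e))%E.
  rewrite [leb4 (tube X e)](BM (tube X e)) (setIidr BT) addeC.
  by rewrite leeD2l //; exact: le_outer_measure.
rewrite -(fineK fT) -(fineK fB) -(fineK fN) -EFinD lee_fin.
move: TC kB; rewrite -(fineK fT) -(fineK fB) !lee_fin /=.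
set T := fine _; set Bv := fine _; set Nv := fine _ => TC kB NBT.
have e3 : 0 < e ^+ 3 by rewrite exprn_gt0.
have T0 : 0 < T.
  have : 0 < k * e ^+ 3 by rewrite mulr_gt0.
  have Nv0 : 0 <= Nv by rewrite /Nv fine_ge0 ?outer_measure_ge0.
  lra.
have : k / C <= 1 - Nv / T.
  have -> : 1 - Nv / T = (T - Nv) / T by rewrite mulrBl divff ?gt_eqF.
  rewrite ler_pdivlMr // mulrAC ler_pdivrMr //.
  have : k * T <= k * (C * e ^+ 3) by rewrite ler_pM2l.
  have : C * (k * e ^+ 3) <= C * (T - Nv) by rewrite ler_pM2l //; lra.
  lra.
by move=> h; apply: le_trans h (ler_norm _).
Unshelve. all: by end_near. Qed.

End Measure.

(** * The volume of tubes around polygonal cycles *)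

Section Tube.
Context {R : realType}.

Definition coord_close (r : R) (p q : state R) : Prop :=
  let: (p1, p2, p3, p4) := p in let: (q1, q2, q3, q4) := q in
  [/\ `|p1 - q1| <= r, `|p2 - q2| <= r, `|p3 - q3| <= r & `|p4 - q4| <= r].

Lemma coord_close_eucl_dist e p q : eucl_dist p q < e -> coord_close e p q.
Proof.
case: p => [[[p1 p2] p3] p4]; case: q => [[[q1 q2] q3] q4] /= h.
have le_e (x S : R) : x ^+ 2 <= S -> Num.sqrt S < e -> `|x| <= e.
  by move=> xS Se; apply: le_trans (ltW Se); rewrite -sqrtr_sqr ler_wsqrtr.
have [[[s1 s2] s3] s4] := (sqr_ge0 (p1 - q1), sqr_ge0 (p2 - q2),
                       sqr_ge0 (p3 - q3), sqr_ge0 (p4 - q4)).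
by split; apply: (le_e _ _ _ h); lra.
Qed.

Lemma tube_coord_close X e p : X !=set0 -> tube X e p -> exists2 q, X q & coord_close e p q.
Proof.
move=> [x Xx] [_ pX].
apply: contrapT => /forall2NP nq.
suff : e <= set_dist p X by rewrite leNgt pX.
apply: lb_le_inf; first by exists (eucl_dist p x); exists x.
move=> _ [q Xq <-]; rewrite leNgt; apply/negP => /coord_close_eucl_dist pq.
by case: (nq q).
Qed.

Lemma leb4_cube (c : state R) (r : R) : 0 <= r ->
  (leb4 [set p | coord_close r p c] <= ((2 * r) ^+ 4)%:E)%E.
Proof.
case: c => [[[c1 c2] c3] c4] r0.
have sub x : x - r <= x + r by lra.
apply: (@le_trans _ _ (leb4 (rect `[c1 - r, c1 + r] `[c2 - r, c2 + r]
                                  `[c3 - r, c3 + r] `[c4 - r, c4 + r]))).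
  apply: le_outer_measure => -[[[p1 p2] p3] p4] /= [h1 h2 h3 h4].
  by split; [split; [split|]|] => /=; rewrite in_itv /= -ler_distl.
by rewrite leb4_rect ?sub // lee_fin le_eqVlt; apply/orP; left; apply/eqP; ring.
Qed.

Definition near_segment (v v' : state R) (e : R) : set (state R) :=
  [set p | exists2 s : R, 0 <= s <= 1 & coord_close e p ((1 - s) *: v + s *: v')].

(** About 1 / e cubes of side 4 e, centred at equally spaced points, cover
    the neighbourhood. Unlike an enclosing box this also gives the order e^3
    for the diagonal edges from S to R. *)
Lemma leb4_near_segment (v v' : state R) (e : R) : 0 < e <= 1 -> coord_close 1 v v' ->
  (leb4 (near_segment v v' e) <= (768 * e ^+ 3)%:E)%E.
Proof.
move=> /andP[e0 e1] vv'.
(* With n > 1 / e, consecutive nodes on the segment are less than e apart. *)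
pose n := (Num.truncn e^-1).+1.
have /andP[ln un] : e^-1 < n%:R <= e^-1 + 1.
  have /truncn_itv /andP[h1 h2] : 0 <= e^-1 by rewrite invr_ge0 ltW.
  by rewrite h2 /n -natr1 lerD2r h1.
have n0 : 0 < n%:R :> R by rewrite ltr0n.
have ne : n%:R^-1 <= e by rewrite -[e]invrK lef_pV2 ?posrE ?invr_gt0 // ltW.
pose node k := (1 - k%:R / n%:R) *: v + (k%:R / n%:R) *: v'.
pose cube k : set (state R) := [set p | coord_close (2 * e) p (node k)].
apply: (@le_trans _ _ (leb4 (\big[setU/set0]_(k < n.+1) cube k))).
  apply: le_outer_measure => p [s /andP[s0 s1] ps].
  have sn0 : 0 <= s * n%:R by rewrite mulr_ge0.
  have /andP[k1 k2] := truncn_itv sn0.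
  set k := Num.truncn _ in k1 k2.
  have kn : (k < n.+1)%N.
    by rewrite ltnS -(ler_nat R); apply: le_trans k1 _; rewrite ler_piMl.
  rewrite -(bigcup_mkord _ cube); exists k => //; rewrite /cube /node /=.
  have sk : `|s - k%:R / n%:R| <= e.
    apply: le_trans ne.
    rewrite -(ler_pM2r n0) mulVf ?gt_eqF // -{2}(gtr0_norm n0) -normrM mulrBl divfK ?gt_eqF //.
    by rewrite ger0_norm ?subr_ge0 // lerBlDl natr1 ltW.
  have split_le (x a b : R) : `|x - ((1 - s) * a + s * b)| <= e -> `|a - b| <= 1 ->
      `|x - ((1 - k%:R / n%:R) * a + k%:R / n%:R * b)| <= 2 * e.
    move=> h1 h2.
    have -> : x - ((1 - k%:R / n%:R) * a + k%:R / n%:R * b) = 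
       (x - ((1 - s) * a + s * b)) - (s - k%:R / n%:R) * (a - b) by ring.
    have -> : 2 * e = e + e by ring.
    apply: le_trans (ler_normB _ _) _; rewrite lerD //.
    by rewrite normrM -[leRHS]mulr1 ler_pM.
  case: v vv' ps {cube node} => [[[v1 v2] v3] v4].
  case: v' => [[[w1 w2] w3] w4]; case: p => [[[p1 p2] p3] p4] /= [a1 a2 a3 a4] [b1 b2 b3 b4].
  by split; apply: split_le.
apply: le_trans (outer_measure_subadditive _ cube _) _.
apply: (@le_trans _ _ (\sum_(k < n.+1) ((2 * (2 * e)) ^+ 4)%:E)%E).
  by apply: lee_sum => k _; apply: leb4_cube; lra.
rewrite sumEFin sumr_const card_ord lee_fin -[leLHS]mulr_natr -(natr1 n).
have -> : 768 * e ^+ 3 = (2 * (2 * e)) ^+ 4 * (3 * e^-1) by field; rewrite gt_eqF.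
rewrite ler_wpM2l ?exprn_ge0 //; first by lra.
have : 1 <= e^-1 by rewrite -invr1 lef_pV2 ?posrE.
lra.
Qed.

Lemma leb4_tube_cycle (c : seq (state R)) (e : R) : c != [::] -> 0 < e <= 1 ->
  (forall v, v \in c -> coord_close 1 v (next c v)) ->
  (leb4 (tube (cycle_of c) e) <= ((768 * (size c)%:R) * e ^+ 3)%:E)%E.
Proof.
move=> c0 he hc.
have X0 : cycle_of c !=set0.
  by case: c c0 {hc} => // v c _; exists v; left => /=; rewrite mem_head.
pose F k := near_segment (nth 0 c k) (next c (nth 0 c k)) e.
apply: (@le_trans _ _ (leb4 (\big[setU/set0]_(k < size c) F k))).
  apply: le_outer_measure => p /(tube_coord_close X0) [q Xq pq].
  have [v vc [s s01 qE]] : exists2 v, v \in c & exists2 s : R, 0 <= s <= 1 & q = (1 - s) *: v + s *: next c v.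
    case: Xq => [qc|[v vc [s /andP[s0 s1] qE]]].
      by exists q => //; exists 0; rewrite ?lexx ?ler01 // subr0 scale1r scale0r addr0.
    by exists v => //; exists s => //; rewrite !ltW.
  rewrite -(bigcup_mkord _ F); exists (index v c); first by rewrite /= index_mem.
  by exists s => //; rewrite nth_index // -qE.
apply: le_trans (outer_measure_subadditive _ F _) _.
apply: (@le_trans _ _ (\sum_(k < size c) (768 * e ^+ 3)%:E)%E).
  apply: lee_sum => k _; apply: leb4_near_segment => //.
  by apply: hc; rewrite mem_nth.
rewrite sumEFin sumr_const card_ord lee_fin -[leLHS]mulr_natr.
by rewrite le_eqVlt; apply/orP; left; apply/eqP; ring.
Qed.

End Tube.

(** * Growth rates, exit times and logarithms *)

Section Calculus.
Context {R : realType}.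
Implicit Types (f df : R -> R) (s t m M l : R).

Lemma is_derive_continuous f t d : is_derive t 1 f d -> {for t, continuous f}.
Proof. by move=> [/derivable1_diffP/differentiable_continuous]. Qed.

Lemma continuous_within_itv f s t :
  (forall r, s <= r -> {for r, continuous f}) -> {within `[s, t], continuous f}.
Proof.
move=> cf; apply: continuous_in_subspaceT => r.
by rewrite inE /= in_itv /= => /andP[sr _]; exact: cf.
Qed.

Lemma rate_bounds f df m M s t : s <= t ->
  (forall r, s <= r <= t -> is_derive r 1 f (df r) /\ m <= df r <= M) ->
  m * (t - s) <= f t - f s <= M * (t - s).
Proof.
rewrite le_eqVlt => /predU1P[->|st] h; first by rewrite !subrr !mulr0 lexx.
have [||c] := @MVT R f df s t st.
- move=> r; rewrite in_itv /= => /andP[sr rt].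
  by have [|] := h r; rewrite ?(ltW sr) ?(ltW rt).
- apply: continuous_in_subspaceT => r; rewrite inE /= in_itv /= => srt.
  by have [/is_derive_continuous] := h r srt.
rewrite in_itv /= => /andP[sc ct] ->.
have [|_ /andP[mc cM]] := h c; first by rewrite (ltW sc) (ltW ct).
by rewrite !ler_pM2r ?subr_gt0 // mc.
Qed.

(** The exit time is the infimum of the times at which f = l; the
    intermediate value theorem excludes larger values before it. *)
Lemma first_hit f l s t : s <= t ->
  (forall r, s <= r -> {for r, continuous f}) -> f s < l -> l <= f t ->
  exists T, [/\ s < T <= t, f T = l & forall r, s <= r <= T -> f r <= l].
Proof.
move=> st cf fs ft.
have hit r : s <= r -> l <= f r -> exists2 c, s <= c <= r & f c = l.
  move=> sr fr; have [||c] := @IVT R f s r l sr; last first.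
  - by rewrite in_itv /= => sc fc; exists c.
  - have fsr : f s <= f r by lra.
    by rewrite min_l // max_r // fr ltW.
  - exact: continuous_within_itv.
pose B := [set r | s <= r <= t /\ f r = l].
have B0 : B !=set0 by have [c sc fc] := hit t st ft; exists c.
have Bs : lbound B s by move=> r [/andP[]].
have iB : has_inf B by split; last by exists s.
have sT : s <= inf B by exact: lb_le_inf.
have Tmin r : B r -> inf B <= r by move=> Br; apply: ge_inf => //; exists s.
have Tt : inf B <= t.
  by have [c Bc] := B0; apply: le_trans (Tmin c Bc) _; case: Bc => /andP[].
have fT : f (inf B) = l.
  apply/eqP/negPn/negP => fTl.
  have d0 : 0 < `|l - f (inf B)| by rewrite normr_gt0 subr_eq0 eq_sym.
  have /cvgrPdist_lt /(_ _ d0) := cf _ sT.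
  move=> /nbhs_ballP[d /= d1 hd].
  have [b Bb bT] := inf_adherent d1 iB.
  have : ball (inf B) d b.
    by rewrite /ball /= distrC ger0_norm ?subr_ge0 ?Tmin // ltrBlDl.
  by move=> /hd /=; case: Bb => _ ->; rewrite distrC ltxx.
exists (inf B); split => //.
  rewrite Tt andbT lt_neqAle sT andbT; apply/eqP => sE.
  by move: fs; rewrite sE fT ltxx.
move=> r /andP[sr rT]; rewrite leNgt; apply/negP => lr.
have [c /andP[sc cr] fc] := hit r sr (ltW lr).
have := Tmin c; rewrite /B /= sc (le_trans cr) ?(le_trans rT) //= => /(_ (conj isT fc)) Tc.
have rE : r = inf B by apply/le_anti; rewrite rT (le_trans Tc).
by move: lr; rewrite rE fT ltxx.
Qed.

(** The hypothesis that the bound fails somewhere is how bootstrap arguments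
    use this: estimates valid as long as f and g stay below l show that they
    cannot do so until time t. *)
Lemma first_exit f g l s t : s <= t ->
  (forall r, s <= r -> {for r, continuous f}) ->
  (forall r, s <= r -> {for r, continuous g}) -> f s < l -> g s < l ->
  ~ (forall r, s <= r <= t -> f r <= l /\ g r <= l) ->
  exists T, [/\ s < T <= t, f T = l \/ g T = l &
                forall r, s <= r <= T -> f r <= l /\ g r <= l].
Proof.
move=> st cf cg fs gs nle.
have sub (h1 h2 : R -> R) T : s < T <= t ->
    (forall r, s <= r -> {for r, continuous h2}) -> h2 s < l ->
    h1 T = l -> (forall r, s <= r <= T -> h1 r <= l) ->
    exists T', [/\ s < T' <= t, h1 T' = l \/ h2 T' = l &
                forall r, s <= r <= T' -> h1 r <= l /\ h2 r <= l].
  move=> /andP[sT Tt] ch2 h2s h1T h1l.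
  have [h2l|] := pselect (forall r, s <= r <= T -> h2 r <= l).
    by exists T; rewrite sT Tt; split=> //; [left | move=> r sr; split; [exact: h1l | exact: h2l]].
  move=> /existsNP[r /not_implyP[/andP[sr rT] /negP]]; rewrite -ltNge => lr.
  have [T' [/andP[sT' T'r] h2T' h2l]] := first_hit sr ch2 h2s (ltW lr).
  exists T'; rewrite sT' (le_trans T'r) ?(le_trans rT) //; split=> //; first by right.
  move=> q /andP[sq qT']; split; last by apply: h2l; rewrite sq.
  by apply: h1l; rewrite sq (le_trans qT') // (le_trans T'r).
have [fl|] := pselect (forall r, s <= r <= t -> f r <= l); last first.
  move=> /existsNP[r /not_implyP[/andP[sr rt] /negP]]; rewrite -ltNge => lr.
  have [T [/andP[sT Tr] fT fl]] := first_hit sr cf fs (ltW lr).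
  by apply: sub fT fl => //; rewrite sT (le_trans Tr).
have [gl|] := pselect (forall r, s <= r <= t -> g r <= l).
  by case: nle => r sr; split; [exact: fl | exact: gl].
move=> /existsNP[r /not_implyP[/andP[sr rt] /negP]]; rewrite -ltNge => lr.
have [T [/andP[sT Tr] gT gl]] := first_hit sr cg gs (ltW lr).
exists T; rewrite sT (le_trans Tr) //; split=> //; first by right.
move=> q /andP[sq qT]; split; last by apply: gl; rewrite sq.
by apply: fl; rewrite sq (le_trans qT) // (le_trans Tr).
Qed.

Lemma ln_le_addl (a b k : R) : 0 < a -> 0 < b -> 0 < k -> a <= k * b ->
  ln a <= ln b + (k - 1).
Proof.
move=> a0 b0 k0 ab.
have : ln a <= ln (k * b) by rewrite ler_ln ?posrE ?mulr_gt0.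
rewrite lnM ?posrE // => h.
have := @le_ln1Dx R (k - 1); have -> : 1 + (k - 1) = k by ring.
move=> kk.
by apply: le_trans h _; rewrite addrC lerD2l kk //; lra.
Qed.

Lemma ratio_le_of_ln (a b k : R) : 0 < a -> 0 < b -> 0 < k ->
  ln a - ln b <= ln k -> a <= k * b.
Proof.
move=> a0 b0 k0; rewrite lerBlDr -lnM ?posrE // ler_ln ?posrE ?mulr_gt0 //.
Qed.

End Calculus.

(** * Logarithmic ratios along replicator orbits *)

Section Orbits.
Context {R : realType}.
Implicit Types (e f s t : R).

Definition log_ratio (a b : R -> R) (t : R) : R := ln (a t) - ln (b t).

(** In the replicator system g is the mean payoff, up to a constant. Leaving
    it unspecified makes the equations visibly invariant under cyclic
    rotation of the strategies, and nothing is lost since g cancels in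
    quotients of coordinates. *)
Definition player_orbit (e : R) (x1 x2 x3 y1 y2 y3 : R -> R) : Prop :=
  exists g : R -> R, forall t, 0 <= t ->
    [/\ 0 < x1 t, 0 < x2 t, 0 < x3 t & x1 t + x2 t + x3 t = 1] /\
    [/\ is_derive t 1 x1 (x1 t * (e * y1 t + y2 t - y3 t - g t)),
        is_derive t 1 x2 (x2 t * (- y1 t + e * y2 t + y3 t - g t)) &
        is_derive t 1 x3 (x3 t * (y1 t - y2 t + e * y3 t - g t))].

Lemma player_orbit_rot e x1 x2 x3 y1 y2 y3 :
  player_orbit e x1 x2 x3 y1 y2 y3 -> player_orbit e x3 x1 x2 y3 y1 y2.
Proof.
move=> [g H]; exists g => t /H[[p1 p2 p3 p4] [d1 d2 d3]]; split.
  by split=> //; rewrite -p4; ring.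
by split; [move: d3|move: d1|move: d2] => /is_derive_eq; apply; ring.
Qed.

Lemma player_orbit_simplex e x1 x2 x3 y1 y2 y3 t : 0 <= t ->
  player_orbit e x1 x2 x3 y1 y2 y3 ->
  [/\ 0 < x1 t, 0 < x2 t, 0 < x3 t & x1 t + x2 t + x3 t = 1].
Proof. by move=> t0 [g] /(_ t t0)[]. Qed.

Lemma is_derive_log_ratio (a b : R -> R) (t da db : R) : 0 < a t -> 0 < b t ->
  is_derive t 1 a (a t * da) -> is_derive t 1 b (b t * db) ->
  is_derive t 1 (log_ratio a b) (da - db).
Proof.
move=> a0 b0 Da Db.
have lnD (c : R -> R) dc : 0 < c t -> is_derive t 1 c (c t * dc) ->
    is_derive t 1 (@ln R \o c) dc.
  move=> c0 Dc; have Dl := is_derive1_ln c0.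
  have := is_derive1_comp Dl Dc => /is_derive_eq; apply.
  by rewrite mulrA mulVf ?mul1r // gt_eqF.
by have := is_deriveB (lnD a da a0 Da) (lnD b db b0 Db).
Qed.

Lemma player_log_ratio e x1 x2 x3 y1 y2 y3 t : 0 <= t ->
  player_orbit e x1 x2 x3 y1 y2 y3 ->
  is_derive t 1 (log_ratio x2 x3)
    (- 2 * y1 t + (1 + e) * y2 t + (1 - e) * y3 t) /\
  is_derive t 1 (log_ratio x1 x3)
    ((e - 1) * y1 t + 2 * y2 t - (1 + e) * y3 t).
Proof.
move=> t0 [g] /(_ t t0) [[p1 p2 p3 _] [d1 d2 d3]]; split.
  by have := is_derive_log_ratio p2 p3 d2 d3 => /is_derive_eq; apply; ring.
by have := is_derive_log_ratio p1 p3 d1 d3 => /is_derive_eq; apply; ring.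
Qed.

Section Rates.
Variables (e f : R) (x1 x2 x3 y1 y2 y3 : R -> R) (s t k : R).
Hypotheses (e1 : -1 < e < 1) (s0 : 0 <= s) (st : s <= t).
Hypothesis Ox : player_orbit e x1 x2 x3 y1 y2 y3.
Hypothesis Oy : player_orbit f y1 y2 y3 x1 x2 x3.

Let L2 := log_ratio x2 x3.
Let L1 := log_ratio x1 x3.

Let Ly r : s <= r <= t ->
  [/\ 0 < y1 r, 0 < y2 r, 0 < y3 r & y3 r = 1 - y1 r - y2 r] /\
  [/\ - y1 r <= e * y1 r <= y1 r, - y2 r <= e * y2 r <= y2 r &
      - y3 r <= e * y3 r <= y3 r].
Proof.
move=> /andP[sr rt].
have [h1 h2 h3 h4] := player_orbit_simplex (le_trans s0 sr) Oy.
have h (y : R) : 0 < y -> - y <= e * y <= y.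
  move=> y0; have /andP[a b] := e1.
  by apply/andP; split; nra.
split; last by split; apply: h.
by split=> //; lra.
Qed.

Let Ld r : s <= r <= t -> is_derive r 1 L2
    (- 2 * y1 r + (1 + e) * y2 r + (1 - e) * y3 r) /\
  is_derive r 1 L1
    ((e - 1) * y1 r + 2 * y2 r - (1 + e) * y3 r).
Proof. by move=> /andP[sr _]; apply: player_log_ratio Ox; exact: le_trans sr. Qed.

(** The rates are convex combinations of payoff differences, and these lie in
    [-2, 2]. *)
Lemma log_ratio_rates_any :
  - 2 * (t - s) <= L2 t - L2 s <= 2 * (t - s) /\
  - 2 * (t - s) <= L1 t - L1 s <= 2 * (t - s).
Proof.
split; apply: rate_bounds => // r sr; have [d2 d1] := Ld sr;
(split; [first [exact: d2|exact: d1]|cbv beta]);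
have [[? ? ? ?] [/andP[? ?] /andP[? ?] /andP[? ?]]] := Ly sr; lra.
Qed.

(** In the rates the coefficients of y1 and y2 differ from that of y3 by at
    most 4 in absolute value, so weights of size k cause errors of at most
    8 k. *)
Lemma log_ratio_rates_near3 : (forall r, s <= r <= t -> y1 r <= k /\ y2 r <= k) ->
  (1 - e - 8 * k) * (t - s) <= L2 t - L2 s <= (1 - e + 8 * k) * (t - s) /\
  (- (1 + e) - 8 * k) * (t - s) <= L1 t - L1 s <= (- (1 + e) + 8 * k) * (t - s).
Proof.
move=> yk; split; apply: rate_bounds => // r sr; have [d2 d1] := Ld sr;
(split; [first [exact: d2|exact: d1]|cbv beta]);
have [[? ? ? ->] [/andP[? ?] /andP[? ?] /andP[? ?]]] := Ly sr;
have [? ?] := yk r sr; lra.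
Qed.

Lemma log_ratio_rates_near2 : (forall r, s <= r <= t -> y1 r <= k /\ y3 r <= k) ->
  (1 + e - 8 * k) * (t - s) <= L2 t - L2 s <= (1 + e + 8 * k) * (t - s) /\
  (2 - 8 * k) * (t - s) <= L1 t - L1 s <= (2 + 8 * k) * (t - s).
Proof.
move=> yk; split; apply: rate_bounds => // r sr; have [d2 d1] := Ld sr;
(split; [first [exact: d2|exact: d1]|cbv beta]);
have [[? ? ? y3E] [/andP[? ?] /andP[? ?] /andP[? ?]]] := Ly sr;
have [? ?] := yk r sr;
have ey2 : e * y2 r = e - e * y1 r - e * y3 r by rewrite y3E; ring.
all: lra.
Qed.

End Rates.
End Orbits.

(** * One passage from a tie to the next *)

Section Step.
Context {R : realType}.
Implicit Types (s t : R).

Definition rsp_orbit (e f : R) (x1 x2 x3 y1 y2 y3 : R -> R) : Prop :=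
  player_orbit e x1 x2 x3 y1 y2 y3 /\ player_orbit f y1 y2 y3 x1 x2 x3.

(** In the order of travel, each triple lists the coordinates that vanish on
    an edge of C1: two of the player who rests and one of the player who
    moves. Rotating the strategies rotates this list by two. *)
Definition near_edges (k x1 x2 x3 y1 y2 y3 : R) : bool :=
  has (fun c => [&& c.1.1 <= k, c.1.2 <= k & c.2 <= k])
    [:: (y1, y2, x1); (x3, x1, y1); (y3, y1, x3);
        (x2, x3, y3); (y2, y3, x2); (x1, x2, y2)].

Lemma near_edges_rot k x1 x2 x3 y1 y2 y3 :
  near_edges k x3 x1 x2 y3 y1 y2 = near_edges k x1 x2 x3 y1 y2 y3.
Proof.
exact: (has_rot 2 [:: (y1, y2, x1); (x3, x1, y1); (y3, y1, x3);
                      (x2, x3, y3); (y2, y3, x2); (x1, x2, y2)]).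
Qed.

(** The section is the middle of the edge from (P, R) to (P, P), where y1 and
    y3 are comparable. The bounds on w / u and v / u define the cone that is
    mapped into its interior. *)
Definition in_cone (L : R) (x1 x2 x3 y1 y2 y3 : R -> R) (t : R) : Prop :=
  let u := log_ratio x3 x2 t in let v := log_ratio x3 x1 t in
  let w := log_ratio y3 y2 t in
  [/\ L <= u, u / 4 <= w <= 2 * u, u / 20 / 10 <= v <= 3 / 2 * u &
      -1 <= log_ratio y1 y3 t <= 1].

(** A window at the boundary point (1/2, 1) of the parameter square. In the
    limit eX = 1/2, eY = 1 the passage along the cycle has the simple form
    described at [cone_contraction]. *)
Definition admissible (e f : R) : Prop :=
  1 / 2 - th / 2 < e < 1 / 2 + th / 2 /\ 1 - th / 2 < f < 1.

Lemma share_small (k a b : R) : 0 < k -> 0 < a -> 0 < b <= 1 ->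
  ln a - ln b <= ln k -> a <= k.
Proof.
move=> k0 a0 /andP[b0 b1] /(ratio_le_of_ln a0 b0 k0) ak.
by apply: le_trans ak _; rewrite ler_piMr // ltW.
Qed.

Lemma widen_rates (a b m M x d : R) : 0 <= d -> a <= m -> M <= b ->
  m * d <= x <= M * d -> a * d <= x <= b * d.
Proof.
move=> d0 am Mb /andP[h1 h2]; apply/andP; split.
  by apply: le_trans h1; rewrite ler_wpM2r.
by apply: (le_trans h2); rewrite ler_wpM2r.
Qed.

Lemma shift_bounds (a b d h : R) : - 2 * d <= a - b <= 2 * d -> d <= h ->
  b - 2 * h <= a <= b + 2 * h.
Proof. by move=> /andP[? ?] ?; apply/andP; split; lra. Qed.

Lemma widen_bounds (a b c d h x : R) : x - c * h <= a <= x + c * h ->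
  a - d * h <= b <= a + d * h -> x - (c + d) * h <= b <= x + (c + d) * h.
Proof. by move=> /andP[? ?] /andP[? ?]; apply/andP; split; lra. Qed.

Lemma before_corner (u v w h l a1 a2 b1 : R) : u = 10 * (10 * (10 * h)) ->
  - h <= l -> 0 < h -> u / 4 <= w -> u / 20 / 10 <= v ->
  a1 <= - u + h -> a2 <= - v + h -> b1 <= - w + h ->
  [/\ a1 <= l, a2 <= l & b1 <= l].
Proof. by move=> *; split; lra. Qed.

(** The algebraic core: the image of the cone under (u, v, w) |-> (v + 3 u +
    w, w / 4, 4 u - w), perturbed by errors proportional to h = u / 1000, is
    again in the cone, and u is at least tripled. *)
Lemma cone_contraction (u v w h a1 a2 b : R) : u = 10 * (10 * (10 * h)) ->
  0 < h -> u / 4 <= w <= 2 * u -> u / 20 / 10 <= v <= 3 / 2 * u ->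
  - 4 * u + w - 192 * h <= b <= - 4 * u + w + 192 * h ->
  w / 4 - 26 * h <= a1 <= w / 4 + 26 * h ->
  - v - 3 * u - 3 / 4 * w - 92 * h <= a2
    <= - v - 3 * u - 3 / 4 * w + 92 * h ->
  [/\ 3 * u <= a1 - a2, (a1 - a2) / 4 <= - b <= 2 * (a1 - a2),
      (a1 - a2) / 20 / 10 <= a1 <= 3 / 2 * (a1 - a2) & h <= a1 /\ b <= - h].
Proof.
move=> uh h0 /andP[? ?] /andP[? ?] /andP[? ?] /andP[? ?] /andP[? ?].
by split; [lra|apply/andP; split; lra|apply/andP; split; lra|split; lra].
Qed.

(** The first y-ratio b1 is known at the exit, so the time d since the change of
    x is known up to errors proportional to h; the other ratios follow. *)
Lemma exit_values (u v w h l d a1 a2 b1 b2 : R) : u = 10 * (10 * (10 * h)) ->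
  - h <= l <= 0 -> u / 4 <= w <= 2 * u ->
  - u - h + (1 / 2 - th) * (2 * u + 10 * h + d) <= a1
    <= - u + h + (1 / 2 + th) * (2 * u + 10 * h + d) ->
  - v - h + (- 3 / 2 - th) * (2 * u + 10 * h + d) <= a2
    <= - v + h + (- 3 / 2 + th) * (2 * u + 10 * h + d) ->
  - w - 45 * h + (2 - th) * d <= b1 -> b1 <= - w + 45 * h + (2 + th) * d ->
  - 4 * u - 70 * h + (2 - th) * d <= b2 ->
  b2 <= - 4 * u + 70 * h + (2 + th) * d -> b1 = l ->
  [/\ - 4 * u + w - 190 * h <= b2 <= - 4 * u + w + 190 * h,
      w / 4 - 24 * h <= a1 <= w / 4 + 24 * h &
      - v - 3 * u - 3 / 4 * w - 90 * h <= a2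
        <= - v - 3 * u - 3 / 4 * w + 90 * h].
Proof.
move=> uh /andP[? ?] /andP[? ?] /andP[? ?] /andP[? ?] ? ? ? ? bl.
by split; apply/andP; split; lra.
Qed.

Section Passage.
Variables (e f k : R) (x1 x2 x3 y1 y2 y3 : R -> R).
Hypotheses (ef : admissible e f) (k0 : 0 < k) (k1 : k <= th / 20).
Hypothesis Oxy : rsp_orbit e f x1 x2 x3 y1 y2 y3.

Let X1 := log_ratio x2 x3.
Let X2 := log_ratio x1 x3.
Let Y1 := log_ratio y2 y3.
Let Y2 := log_ratio y1 y3.

Let e1 : -1 < e < 1. Proof. by case: ef => /andP[? ?] _; lra. Qed.
Let f1 : -1 < f < 1. Proof. by case: ef => _ /andP[? ?]; lra. Qed.

Let xP t : 0 <= t -> [/\ 0 < x1 t <= 1, 0 < x2 t <= 1 & 0 < x3 t <= 1].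
Proof.
by move=> t0; have [? ? ? ?] := player_orbit_simplex t0 Oxy.1; split; lra.
Qed.

Let yP t : 0 <= t -> [/\ 0 < y1 t <= 1, 0 < y2 t <= 1 & 0 < y3 t <= 1].
Proof.
by move=> t0; have [? ? ? ?] := player_orbit_simplex t0 Oxy.2; split; lra.
Qed.

Lemma x_small3 t : 0 <= t -> X1 t <= ln k -> X2 t <= ln k ->
  x1 t <= k /\ x2 t <= k.
Proof.
move=> t0 h1 h2; have [/andP[p1 q1] /andP[p2 q2] p3] := xP t0.
by split; [apply: share_small h2|apply: share_small h1].
Qed.

Lemma y_small3 t : 0 <= t -> Y1 t <= ln k -> Y2 t <= ln k ->
  y1 t <= k /\ y2 t <= k.
Proof.
move=> t0 h1 h2; have [/andP[p1 q1] /andP[p2 q2] p3] := yP t0.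
by split; [apply: share_small h2|apply: share_small h1].
Qed.

Lemma x_small2 t : 0 <= t -> - X1 t <= ln k -> X2 t - X1 t <= ln k ->
  x1 t <= k /\ x3 t <= k.
Proof.
rewrite /X1 /X2 /log_ratio.
move=> t0 h1 h2; have [/andP[p1 q1] p2 /andP[p3 q3]] := xP t0.
by split; apply: (share_small k0 _ p2) => //; lra.
Qed.

Lemma x_rates_near3 s t : 0 <= s -> s <= t ->
  (forall r, s <= r <= t -> Y1 r <= ln k /\ Y2 r <= ln k) ->
  (1 / 2 - th) * (t - s) <= X1 t - X1 s <= (1 / 2 + th) * (t - s) /\
  (- 3 / 2 - th) * (t - s) <= X2 t - X2 s <= (- 3 / 2 + th) * (t - s).
Proof.
move=> s0 st hY.
have hy r : s <= r <= t -> y1 r <= k /\ y2 r <= k.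
  move=> sr; have [h1 h2] := hY r sr; apply: y_small3 => //.
  by case/andP: sr => sr _; exact: le_trans sr.
have := log_ratio_rates_near3 e1 s0 st Oxy.1 Oxy.2 hy; rewrite -/X1 -/X2.
case: ef => /andP[? ?] _ [h1 h2].
have d0 : 0 <= t - s by rewrite subr_ge0.
have [kk0 kk1] := (k0, k1).
by split; [apply: widen_rates h1|apply: widen_rates h2] => //; lra.
Qed.

Lemma y_rates_near3 s t : 0 <= s -> s <= t ->
  (forall r, s <= r <= t -> X1 r <= ln k /\ X2 r <= ln k) ->
  - th * (t - s) <= Y1 t - Y1 s <= th * (t - s) /\
  (- 2 - th) * (t - s) <= Y2 t - Y2 s <= (- 2 + th) * (t - s).
Proof.
move=> s0 st hX.
have hx r : s <= r <= t -> x1 r <= k /\ x2 r <= k.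
  move=> sr; have [h1 h2] := hX r sr; apply: x_small3 => //.
  by case/andP: sr => sr _; exact: le_trans sr.
have := log_ratio_rates_near3 f1 s0 st Oxy.2 Oxy.1 hx; rewrite -/Y1 -/Y2.
case: ef => _ /andP[? ?] [h1 h2].
have d0 : 0 <= t - s by rewrite subr_ge0.
have [kk0 kk1] := (k0, k1).
by split; [apply: widen_rates h1|apply: widen_rates h2] => //; lra.
Qed.

Lemma y_rates_near2 s t : 0 <= s -> s <= t ->
  (forall r, s <= r <= t -> - X1 r <= ln k /\ X2 r - X1 r <= ln k) ->
  (2 - th) * (t - s) <= Y1 t - Y1 s <= (2 + th) * (t - s) /\
  (2 - th) * (t - s) <= Y2 t - Y2 s <= (2 + th) * (t - s).
Proof.
move=> s0 st hX.
have hx r : s <= r <= t -> x1 r <= k /\ x3 r <= k.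
  move=> sr; have [h1 h2] := hX r sr; apply: x_small2 => //.
  by case/andP: sr => sr _; exact: le_trans sr.
have := log_ratio_rates_near2 f1 s0 st Oxy.2 Oxy.1 hx; rewrite -/Y1 -/Y2.
case: ef => _ /andP[? ?] [h1 h2].
have d0 : 0 <= t - s by rewrite subr_ge0.
have [kk0 kk1] := (k0, k1).
by split; [apply: widen_rates h1|apply: widen_rates h2] => //; lra.
Qed.

Lemma x_rates_any s t : 0 <= s -> s <= t ->
  - 2 * (t - s) <= X1 t - X1 s <= 2 * (t - s) /\
  - 2 * (t - s) <= X2 t - X2 s <= 2 * (t - s).
Proof.
by move=> s0 st; exact: (log_ratio_rates_any e1 s0 st Oxy.1 Oxy.2).
Qed.

Lemma y_rates_any s t : 0 <= s -> s <= t ->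
  - 2 * (t - s) <= Y1 t - Y1 s <= 2 * (t - s) /\
  - 2 * (t - s) <= Y2 t - Y2 s <= 2 * (t - s).
Proof.
by move=> s0 st; exact: (log_ratio_rates_any f1 s0 st Oxy.2 Oxy.1).
Qed.

(** While y is near its third strategy, X1 grows at a rate near 1/2, so x
    changes from strategy 3 to strategy 2 at some time between 2 u - 10 h and
    2 u + 10 h after s. The moment is not known more precisely, but over this
    interval of length 20 h the y-ratios change by at most 40 h, which is a
    small relative error. The third item concerns the time until the change is
    complete, the last one the time after it. *)
Lemma passage_estimates (s u v w h T : R) : 0 <= s -> s <= T -> u = 10 * (10 * (10 * h)) ->
  - h <= ln k <= 0 -> 0 < h ->
  u / 4 <= w <= 2 * u -> u / 20 / 10 <= v <= 3 / 2 * u ->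
  - u - h <= X1 s <= - u + h -> - v - h <= X2 s <= - v + h ->
  - w - h <= Y1 s <= - w + h -> - h <= Y2 s < ln k ->
  (forall r, s <= r <= T -> Y1 r <= ln k /\ Y2 r <= ln k) ->
  [/\ - u - h + (1 / 2 - th) * (T - s) <= X1 T
        <= - u + h + (1 / 2 + th) * (T - s),
      - v - h + (- 3 / 2 - th) * (T - s) <= X2 T
        <= - v + h + (- 3 / 2 + th) * (T - s),
      T <= s + 2 * u + 10 * h -> Y1 T < ln k /\ Y2 T < ln k &
      s + 2 * u + 10 * h <= T ->
        let d := T - (s + 2 * u + 10 * h) in
        - w - 45 * h + (2 - th) * d <= Y1 T
          <= - w + 45 * h + (2 + th) * d /\
        - 4 * u - 70 * h + (2 - th) * d <= Y2 T
          <= - 4 * u + 70 * h + (2 + th) * d].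
Proof.
move=> s0 sT uh /andP[lh l0] h0 /andP[w1 w2] /andP[v1 v2] /andP[X1a X1b] /andP[X2a X2b]
  /andP[Y1a Y1b] /andP[Y2a Y2b] hY.
have X r : s <= r <= T -> 
   - u - h + (1 / 2 - th) * (r - s) <= X1 r
        <= - u + h + (1 / 2 + th) * (r - s) /\
   - v - h + (- 3 / 2 - th) * (r - s) <= X2 r
        <= - v + h + (- 3 / 2 + th) * (r - s).
  move=> /andP[sr rT].
  have hYr q : s <= q <= r -> Y1 q <= ln k /\ Y2 q <= ln k.
    by move=> /andP[sq qr]; apply: hY; rewrite sq (le_trans qr).
  have [/andP[? ?] /andP[? ?]] := x_rates_near3 s0 sr hYr.
  by split; lra.
have [XT1 XT2] : - u - h + (1 / 2 - th) * (T - s) <= X1 T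
        <= - u + h + (1 / 2 + th) * (T - s) /\
   - v - h + (- 3 / 2 - th) * (T - s) <= X2 T
        <= - v + h + (- 3 / 2 + th) * (T - s).
  by apply: X; rewrite sT lexx.
pose s1 := s + 2 * u - 10 * h; pose s2 := s + 2 * u + 10 * h.
(* Until s1 the first player certainly still plays the third strategy. *)
have start r : s <= r -> r <= T -> r <= s1 ->
    - w - h - th * (r - s) <= Y1 r <= - w + h + th * (r - s) /\
    Y2 s + (- 2 - th) * (r - s) <= Y2 r
      <= Y2 s + (- 2 + th) * (r - s).
  move=> sr rT rs1; have hXr q : s <= q <= r -> X1 q <= ln k /\ X2 q <= ln k.
    move=> /andP[sq qr]; have [|] := X q; first by rewrite sq (le_trans qr).
    rewrite /s1 in rs1; move=> /andP[_ ?] /andP[_ ?]; split; lra.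
  have [/andP[? ?] /andP[? ?]] := y_rates_near3 s0 sr hXr.
  by split; lra.
have s1s : s <= s1 by rewrite /s1; lra.
have middle r : s1 <= r -> r <= T -> r <= s2 ->
    - w - 43 * h <= Y1 r <= - w + 43 * h /\
    - 4 * u - 68 * h <= Y2 r <= - 4 * u + 68 * h.
  move=> s1r rT rs2.
  have := start s1 s1s (le_trans s1r rT) (lexx _).
  have := y_rates_any (le_trans s0 s1s) s1r.
  rewrite /s1 /s2 in s1r rs2 *.
  by move=> [/andP[? ?] /andP[? ?]] [/andP[? ?] /andP[? ?]]; split; lra.
split => //.
  rewrite -/s2 => Ts2; have [Ts1|s1T] := leP T s1.
    have [/andP[? ?] /andP[? ?]] := start T sT (lexx _) Ts1.
    rewrite /s1 in Ts1; split; lra.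
  have [/andP[? ?] /andP[? ?]] := middle T (ltW s1T) (lexx _) Ts2.
  split; lra.
rewrite -/s2 => s2T d.
have s2s : s <= s2 by rewrite /s2; lra.
have hXr q : s2 <= q <= T -> - X1 q <= ln k /\ X2 q - X1 q <= ln k.
  move=> /andP[s2q qT]; have [|] := X q; first by rewrite (le_trans s2s).
  rewrite /s2 in s2q; move=> /andP[? ?] /andP[? ?]; split; lra.
have := y_rates_near2 (le_trans s0 s2s) s2T hXr.
have s12 : s1 <= s2 by rewrite /s1 /s2; lra.
have := middle s2 s12 s2T (lexx _).
rewrite -/d => -[/andP[? ?] /andP[? ?]] [/andP[? ?] /andP[? ?]]; split; lra.
Qed.

Lemma continuous_log_ratios r : 0 <= r ->
  [/\ {for r, continuous X1}, {for r, continuous X2},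
      {for r, continuous Y1} & {for r, continuous Y2}].
Proof.
move=> r0; have [dX1 dX2] := player_log_ratio r0 Oxy.1.
have [dY1 dY2] := player_log_ratio r0 Oxy.2.
by split; [exact: is_derive_continuous dX1|exact: is_derive_continuous dX2
          |exact: is_derive_continuous dY1|exact: is_derive_continuous dY2].
Qed.

Lemma ln_k_lt0 : ln k < 0.
Proof. by apply: ln_lt0; have [? ?] := (k0, k1); lra. Qed.

(** The estimates above hold only while y1 and y2 are small, so they are
    applied up to the first exit time T. Before the change of x both y-ratios
    are far below the threshold, and afterwards Y1 starts at least about 2 u
    above Y2 while both grow at rates near 2; hence it is Y1 that reaches the
    threshold. *)
Lemma corner_passage (s u v w h : R) : 0 <= s -> u = 10 * (10 * (10 * h)) ->
  - h <= ln k -> 0 < h ->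
  u / 4 <= w <= 2 * u -> u / 20 / 10 <= v <= 3 / 2 * u ->
  - u - h <= X1 s <= - u + h -> - v - h <= X2 s <= - v + h ->
  - w - h <= Y1 s <= - w + h -> - h <= Y2 s < ln k ->
  exists T, [/\ s <= T /\ Y1 T = ln k,
    forall r, s <= r <= T -> [/\ Y1 r <= ln k, Y2 r <= ln k & X2 r <= ln k],
    - 4 * u + w - 190 * h <= Y2 T <= - 4 * u + w + 190 * h,
    w / 4 - 24 * h <= X1 T <= w / 4 + 24 * h &
    - v - 3 * u - 3 / 4 * w - 90 * h <= X2 T
      <= - v - 3 * u - 3 / 4 * w + 90 * h].
Proof.
move=> s0 uh lh h0 hw hv hX1 hX2 hY1 hY2.
have l0 := ln_k_lt0.
have lhl : - h <= ln k <= 0 by rewrite lh ltW.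
pose s2 := s + 2 * u + 10 * h.
have bulk T sT := passage_estimates s0 sT uh lhl h0 hw hv hX1 hX2 hY1 hY2 (T := T).
have [w1 w2] := andP hw; have [v1 v2] := andP hv.
have [Y2a Y2b] := andP hY2; have [Y1a Y1b] := andP hY1.
have s2s : s <= s2 by rewrite /s2; lra.
have st : s <= s2 + 2 * u by lra.
have cY1 r : s <= r -> {for r, continuous Y1}.
  by move=> sr; case: (continuous_log_ratios (le_trans s0 sr)).
have cY2 r : s <= r -> {for r, continuous Y2}.
  by move=> sr; case: (continuous_log_ratios (le_trans s0 sr)).
have Y1s : Y1 s < ln k by lra.
have [|T [/andP[sT Tt] YT YlT]] := first_exit st cY1 cY2 Y1s Y2b.
  move=> hY; have [_ _ _] := bulk _ st hY.
  rewrite -/s2 lerDl => h4; have {h4} [|/andP[Y1t _] _] := h4 _; first by lra.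
  have [|] := hY (s2 + 2 * u); first by rewrite st lexx.
  move: Y1t; have -> : s2 + 2 * u - s2 = 2 * u by ring.
  rewrite -/Y1; lra.
have [XT1 XT2 early late] := bulk T (ltW sT) YlT.
have s2T : s2 <= T.
  rewrite leNgt; apply/negP => /ltW /early []; case: YT; rewrite -/Y1 -/Y2 => ->; rewrite ltxx //.
have {early} := late s2T; rewrite -/s2 -/Y1 -/Y2 => -[/andP[Y1Ta Y1Tb] /andP[Y2Ta Y2Tb]].
have [Y1l Y2l] : Y1 T <= ln k /\ Y2 T <= ln k by apply: YlT; rewrite (ltW sT) lexx.
have Y1T : Y1 T = ln k by case: YT => // Y2T; exfalso; lra.
have TsE : T - s = 2 * u + 10 * h + (T - s2) by rewrite /s2; ring.
rewrite TsE in XT1 XT2.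
have [Y2e X1e X2e] :=
  exit_values uh lhl hw XT1 XT2 Y1Ta Y1Tb Y2Ta Y2Tb Y1T.
exists T; split => //; first by split=> //; exact: ltW.
- move=> r /andP[sr rT]; have [Y1r Y2r] : Y1 r <= ln k /\ Y2 r <= ln k by apply: YlT; rewrite sr.
  split=> //.
  have [|_ /andP[_ X2r] _ _] := bulk r sr.
    by move=> q /andP[sq qr]; apply: YlT; rewrite sq (le_trans qr).
  rewrite -/X2 in X2r; lra.
Qed.

(** One third of a turn around the cycle, in three stages: y finishes its
    move to P in a bounded time; the long stay of y at P, during which x
    moves to S; and the beginning of the move of y to S, again in a bounded
    time. Bounded times are absorbed by the errors because L is large
    compared with - ln k. *)
Lemma cone_passage_step (t0 : R) : 0 <= t0 ->
  in_cone (10 * (10 * (10 * (10 * (10 - ln k))))) x1 x2 x3 y1 y2 y3 t0 ->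
  exists t1, [/\ t0 + 1 <= t1,
    forall t, t0 <= t <= t1 ->
      near_edges k (x1 t) (x2 t) (x3 t) (y1 t) (y2 t) (y3 t) &
    in_cone (3 * log_ratio x3 x2 t0) x3 x1 x2 y3 y1 y2 t1].
Proof.
move=> t00 [].
have l0 := ln_k_lt0.
rewrite (_ : log_ratio x3 x2 t0 = - X1 t0); last by rewrite /X1 /log_ratio opprB.
rewrite (_ : log_ratio x3 x1 t0 = - X2 t0); last by rewrite /X2 /log_ratio opprB.
rewrite (_ : log_ratio y3 y2 t0 = - Y1 t0); last by rewrite /Y1 /log_ratio opprB.
rewrite -/Y2.
move: {-1}(- X1 t0) (erefl (- X1 t0)) {-1}(- X2 t0) (erefl (- X2 t0))
  {-1}(- Y1 t0) (erefl (- Y1 t0)) => u uE v vE w wE Lu hw hv hz.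
pose h := u / 10 / 10 / 10.
have uh : u = 10 * (10 * (10 * h)) by rewrite /h; field.
(* The first stage has the fixed duration D, too short for X1, X2 or Y1 to
   come near ln k. *)
pose D := 2 - ln k; pose s := t0 + D.
have Dh : D <= h / 2 by rewrite /D /h; lra.
have D2 : 1 + 2 * D <= h by rewrite /D /h; lra.
have D1 : 1 <= D by rewrite /D; lra.
have h0 : 0 < h by lra.
have lh : - h <= ln k by rewrite /D in Dh; lra.
have ts : t0 <= s by rewrite lerDl; exact: le_trans D1.
have s0 : 0 <= s := le_trans t00 ts.
have entry r : t0 <= r <= s -> [/\ - u - h <= X1 r <= - u + h,
    - v - h <= X2 r <= - v + h & - w - h <= Y1 r <= - w + h].
  move=> /andP[t0r rs]; have rD : r - t0 <= h / 2.
    by apply: le_trans Dh; rewrite lerBlDl.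
  have := y_rates_any t00 t0r; have := x_rates_any t00 t0r.
  rewrite -/X1 -/X2 -/Y1 -/Y2.
  move=> [/shift_bounds-/(_ _ rD) hX1 /shift_bounds-/(_ _ rD) hX2].
  move=> [/shift_bounds-/(_ _ rD) hY1 _].
  by rewrite -uE -vE -wE !opprK -[h](divfK (_ : 2 != 0)) ?pnatr_eq0 // -mulrC.
have [hX1 hX2 hY1] : [/\ - u - h <= X1 s <= - u + h,
    - v - h <= X2 s <= - v + h & - w - h <= Y1 s <= - w + h].
  by apply: entry; rewrite ts lexx.
have [w1 w2] := andP hw; have [v1 v2] := andP hv.
have start r : t0 <= r <= s -> [/\ X1 r <= ln k, X2 r <= ln k & Y1 r <= ln k].
  move=> /entry[/andP[_ a1] /andP[_ a2] /andP[_ b1]].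
  exact: before_corner uh lh h0 w1 v1 a1 a2 b1.
have hY2 : - h <= Y2 s < ln k.
  have startX r : t0 <= r <= s -> X1 r <= ln k /\ X2 r <= ln k by move=> /start[].
  have := y_rates_near3 t00 ts startX; have := y_rates_any t00 ts.
  have [z1 z2] := andP hz.
  rewrite -/Y1 -/Y2 (_ : s - t0 = D) => [[_ /andP[c1 c2]] [_ /andP[c3 c4]]|]; last by rewrite /s; ring.
  by apply/andP; split; [lra|move: c4; rewrite /D in D1 *; lra].
have [T [[sT Y1T] bulk Y2T X1T X2T]] :=
  corner_passage s0 uh lh h0 hw hv hX1 hX2 hY1 hY2.
have T0 : 0 <= T := le_trans s0 sT.
rewrite -/X1 -/X2 -/Y1 -/Y2 in Y1T Y2T X1T X2T.
pose K := - ln k.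
have K0 : 0 < K by rewrite oppr_gt0.
have Kh : K <= h by rewrite /K lerNl.
have TK : T <= T + K by rewrite lerDl ltW.
(* During the last stage, of length at most K <= h, all ratios change by at most
   2 h. *)
have exit r : T <= r <= T + K ->
    [/\ 3 * u <= X1 r - X2 r, (X1 r - X2 r) / 4 <= - Y2 r <= 2 * (X1 r - X2 r),
      (X1 r - X2 r) / 20 / 10 <= X1 r <= 3 / 2 * (X1 r - X2 r) &
      h <= X1 r /\ Y2 r <= - h].
  move=> /andP[Tr rK]; have rT : r - T <= h.
    by apply: le_trans Kh; rewrite lerBlDl.
  have := y_rates_any T0 Tr; have := x_rates_any T0 Tr.
  rewrite -/X1 -/X2 -/Y1 -/Y2.
  move=> [/shift_bounds-/(_ _ rT) a1 /shift_bounds-/(_ _ rT) a2].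
  move=> [_ /shift_bounds-/(_ _ rT) b].
  have {}b := widen_bounds Y2T b; have {}a1 := widen_bounds X1T a1.
  have {}a2 := widen_bounds X2T a2.
  apply: (cone_contraction uh h0 hw hv).
  - by rewrite (_ : 192 = 190 + 2) //; ring.
  - by rewrite (_ : 26 = 24 + 2) //; ring.
  - by rewrite (_ : 92 = 90 + 2) //; ring.
have x_exit r : T <= r <= T + K -> - X1 r <= ln k /\ X2 r - X1 r <= ln k.
  move=> /exit[u3 _ _ [X1r _]]; split.
    by apply: le_trans lh; rewrite lerN2.
  by apply: le_trans lh; rewrite lerNr opprB; apply: le_trans u3; lra.
have Y1K : 0 <= Y1 (T + K).
  have := y_rates_near2 T0 TK x_exit.
  rewrite -/Y1 -/Y2 (_ : T + K - T = K); last by ring.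
  rewrite Y1T => -[/andP[+ _] _]; rewrite -[ln k]opprK -/K.
  lra.
have [|||t1 [/andP[Tt1 t1K] Y1t1 _]] := @first_hit R Y1 0 T (T + K) TK.
- by move=> r Tr; case: (continuous_log_ratios (le_trans T0 Tr)).
- by rewrite Y1T.
- by [].
exists t1; split.
- by apply: le_trans (ltW Tt1); apply: le_trans sT; rewrite lerD2l.
- move=> t /andP[t0t tt1]; have t'0 := le_trans t00 t0t.
  have [/andP[p1 p1'] /andP[p2 p2'] p3] := xP t'0.
  have [/andP[q1 q1'] /andP[q2 q2'] q3] := yP t'0.
  rewrite /near_edges /=.
  have [ts'|/ltW st] := leP t s.
    have [] := start t; first by rewrite t0t.
    move=> h1 h2 h3; rewrite (share_small k0 p1 p3 h2) (share_small k0 p2 p3 h1).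
    by rewrite (share_small k0 q2 q3 h3) !orbT.
  have [tT|/ltW Tt] := leP t T.
    have [] := bulk t; first by rewrite st.
    move=> h1 h2 h3; rewrite (share_small k0 q1 q3 h2) (share_small k0 q2 q3 h1).
    by rewrite (share_small k0 p1 p3 h3).
  have tTK : T <= t <= T + K by rewrite Tt (le_trans tt1).
  have [_ _ _ [_ /le_trans-/(_ _ lh) h3]] := exit t tTK.
  have [h1 h2] := x_exit t tTK; have [-> ->] := x_small2 t'0 h1 h2.
  by rewrite (share_small k0 q1 q3 h3) !orbT.
have [|u3 w4 v200 _] := exit t1; first by rewrite t1K ltW.
rewrite /in_cone.
rewrite (_ : log_ratio x2 x1 t1 = X1 t1 - X2 t1); last first.
  by rewrite /X1 /X2 /log_ratio; ring.
rewrite (_ : log_ratio y2 y1 t1 = - Y2 t1); last first.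
  by rewrite -[RHS]add0r -Y1t1 /Y1 /Y2 /log_ratio; ring.
rewrite (_ : log_ratio y3 y2 t1 = 0); last first.
  by rewrite -[RHS]oppr0 -Y1t1 /Y1 /log_ratio opprB.
by rewrite -/X1 lerN10 ler01.
Qed.

End Passage.
End Step.

(** * Iterated passages, and escape *)

Section Iteration.
Context {R : realType}.
Implicit Types (s t : R).

Lemma rsp_orbit_rot (e f : R) x1 x2 x3 y1 y2 y3 :
  rsp_orbit e f x1 x2 x3 y1 y2 y3 -> rsp_orbit e f x3 x1 x2 y3 y1 y2.
Proof. by move=> [? ?]; split; exact: player_orbit_rot. Qed.

Lemma near_edgesW (k k' x1 x2 x3 y1 y2 y3 : R) : k <= k' ->
  near_edges k x1 x2 x3 y1 y2 y3 -> near_edges k' x1 x2 x3 y1 y2 y3.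
Proof.
move=> kk; apply: sub_has => c /= /and3P[c1 c2 c3].
by rewrite (le_trans c1) // (le_trans c2) // (le_trans c3).
Qed.

Lemma in_coneW (L L' : R) x1 x2 x3 y1 y2 y3 t : L <= L' ->
  in_cone L' x1 x2 x3 y1 y2 y3 t -> in_cone L x1 x2 x3 y1 y2 y3 t.
Proof. by move=> LL [h1 h2 h3 h4]; split=> //; exact: le_trans h1. Qed.

Lemma cone_passage (e f k : R) : admissible e f -> 0 < k ->
  exists2 L, 0 < L & forall x1 x2 x3 y1 y2 y3,
    rsp_orbit e f x1 x2 x3 y1 y2 y3 -> forall t0, 0 <= t0 ->
    in_cone L x1 x2 x3 y1 y2 y3 t0 ->
    exists t1, [/\ t0 + 1 <= t1,
      forall t, t0 <= t <= t1 ->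
        near_edges k (x1 t) (x2 t) (x3 t) (y1 t) (y2 t) (y3 t) &
      in_cone (3 * log_ratio x3 x2 t0) x3 x1 x2 y3 y1 y2 t1].
Proof.
move=> ef k0; pose k' := Num.min k (th / 20).
have k'0 : 0 < k' by rewrite lt_min k0; lra.
have k'th : k' <= th / 20 by rewrite ge_min lexx orbT.
have k'k : k' <= k by rewrite ge_min lexx.
exists (10 * (10 * (10 * (10 * (10 - ln k'))))).
  by have := ln_k_lt0 k'0 k'th; lra.
move=> x1 x2 x3 y1 y2 y3 O t0 t00 C.
have [t1 [h1 h2 h3]] := cone_passage_step ef k'0 k'th O t00 C.
by exists t1; split=> // t /h2; exact: near_edgesW.
Qed.

(** Every passage takes at least one unit of time and ends, after rotation,
    in the same cone; induction on the integer part of the elapsed time. *)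
Lemma cone_stays (e f k : R) : admissible e f -> 0 < k ->
  exists2 L, 0 < L & forall x1 x2 x3 y1 y2 y3,
    rsp_orbit e f x1 x2 x3 y1 y2 y3 -> forall t0, 0 <= t0 ->
    in_cone L x1 x2 x3 y1 y2 y3 t0 ->
    forall t, t0 <= t ->
      near_edges k (x1 t) (x2 t) (x3 t) (y1 t) (y2 t) (y3 t).
Proof.
move=> ef k0; have [L L0 step] := cone_passage ef k0; exists L => //.
move=> x1 x2 x3 y1 y2 y3 O t0 t00 C t t0t.
have [n] : exists n : nat, t <= t0 + n%:R.
  have : 0 <= t - t0 by rewrite subr_ge0.
  move=> /truncn_itv /andP[_ /ltW]; set n := (_.+1) => tn; exists n.
  by rewrite -lerBlDl.
elim: n x1 x2 x3 y1 y2 y3 O t0 t00 C t0t => [|n IHn] x1 x2 x3 y1 y2 y3 O t0 t00 C t0t tn.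
all: have [t1 [t01 near1 C1]] := step _ _ _ _ _ _ O _ t00 C.
  by apply: near1; rewrite t0t (le_trans tn) // addr0 (le_trans _ t01) // lerDl.
have [tt1|/ltW t1t] := leP t t1; first by apply: near1; rewrite t0t.
have t10 : 0 <= t1 by rewrite (le_trans t00) // (le_trans _ t01) // lerDl.
rewrite -near_edges_rot; apply: IHn (rsp_orbit_rot O) _ t10 _ t1t _.
  apply: in_coneW C1; case: C => Lu _ _ _.
  by lra.
by rewrite (le_trans tn) // -natr1 addrCA addrC lerD2r.
Qed.

(** The threshold L0 must not depend on k. Since u triples at each passage,
    after finitely many of them it exceeds the threshold that confines the
    orbit to a given neighbourhood. *)
Lemma cone_attracted (e f : R) : admissible e f ->
  exists2 L0, 0 < L0 & forall x1 x2 x3 y1 y2 y3,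
    rsp_orbit e f x1 x2 x3 y1 y2 y3 -> forall t0, 0 <= t0 ->
    in_cone L0 x1 x2 x3 y1 y2 y3 t0 -> forall k, 0 < k ->
    exists T, forall t, T <= t ->
      near_edges k (x1 t) (x2 t) (x3 t) (y1 t) (y2 t) (y3 t).
Proof.
move=> ef; have [L0 L00 step] := cone_passage ef ltr01; exists L0 => //.
move=> x1 x2 x3 y1 y2 y3 O t0 t00 C k k0.
have [L _ stays] := cone_stays ef k0.
have [n] : exists n : nat, L - log_ratio x3 x2 t0 <= n%:R * (2 * L0).
  exists (Num.truncn ((L - log_ratio x3 x2 t0) / (2 * L0))).+1.
  by rewrite -ler_pdivrMr ?mulr_gt0 // ltW // truncnS_gt.
elim: n x1 x2 x3 y1 y2 y3 O t0 t00 C => [|n IHn] x1 x2 x3 y1 y2 y3 O t0 t00 C.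
  rewrite mul0r subr_le0 => Lu; exists t0; apply: stays t00 _ => //.
  by case: C => _ h1 h2 h3; split.
rewrite -natr1 => Ln; have [t1 [t01 _ C1]] := step _ _ _ _ _ _ O _ t00 C.
have t10 : 0 <= t1 by rewrite (le_trans t00) // (le_trans _ t01) // lerDl.
case: C => L0u _ _ _; case: (C1) => u1 _ _ _.
have C1' : in_cone L0 x3 x1 x2 y3 y1 y2 t1 by apply: in_coneW C1; lra.
have [|T nearT] := IHn _ _ _ _ _ _ (rsp_orbit_rot O) t1 t10 C1'; first by lra.
by exists T => t /nearT; rewrite near_edges_rot.
Qed.

(** As long as y is near P, x moves to S in a time that does not depend on y.
    From then on (ln (y1 / y2))' = (1 + f) x1 + (1 - f) x2 - 2 x3 >= 0, so y1
    / y2 never falls below a fixed positive constant. When y leaves P the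
    weight y1 is therefore bounded below, whereas a point of the cycle with
    y1 and y3 positive has x3 = 1. *)
Lemma escape (e f : R) : admissible e f ->
  exists m : R, exists2 k : R, 0 < k & forall x1 x2 x3 y1 y2 y3,
    rsp_orbit e f x1 x2 x3 y1 y2 y3 ->
    - 2 <= log_ratio x2 x3 0 -> log_ratio x1 x3 0 <= m ->
    log_ratio y2 y3 0 <= m -> log_ratio y1 y3 0 <= m ->
    - 2 <= log_ratio y1 y2 0 ->
    exists2 T, 0 < T & [/\ k <= y1 T, 1 / 4 <= y3 T & x3 T <= 1 / 2].
Proof.
move=> ef; pose k : R := th / 20.
have k0 : 0 < k by rewrite /k; lra.
have l0 := ln_k_lt0 k0 (lexx k).
have [_ /andP[f0 f1]] := ef.
have c0 : 0 < (1 - f) / 2 by lra.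
have c1 : ln ((1 - f) / 2) < 0 by apply: ln_lt0; lra.
(* After time tc, x3 <= (1 - f) / 2 * x2, so ln (y1 / y2) no longer decreases;
   before, it loses at most 4 tc. *)
pose tc := 4 * (2 - ln ((1 - f) / 2)).
pose C := 2 + 4 * tc.
have tc0 : 0 <= tc by rewrite /tc; lra.
exists (ln k - 20); exists (expR (ln k - C) / 4); first by rewrite divr_gt0 ?expR_gt0.
move=> x1 x2 x3 y1 y2 y3 O X1a X2b Y1b Y2b Zab.
pose X1 := log_ratio x2 x3; pose X2 := log_ratio x1 x3.
pose Y1 := log_ratio y2 y3; pose Y2 := log_ratio y1 y3.
pose Z := log_ratio y1 y2.
have ZE r : Z r = Y2 r - Y1 r by rewrite /Z /Y2 /Y1 /log_ratio; ring.
have cY1 r : 0 <= r -> {for r, continuous Y1}.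
  by move=> r0; case: (continuous_log_ratios O r0).
have cY2 r : 0 <= r -> {for r, continuous Y2}.
  by move=> r0; case: (continuous_log_ratios O r0).
have bulk T : 0 <= T -> (forall r, 0 <= r <= T -> Y1 r <= ln k /\ Y2 r <= ln k) ->
    - 2 + T / 4 <= X1 T /\ X2 T <= ln k.
  move=> T0 hY; have := x_rates_near3 ef k0 (lexx k) O (lexx 0) T0 hY.
  rewrite -/X1 -/X2 subr0 => -[/andP[a1 _] /andP[_ a2]].
  by rewrite -/X1 -/X2 in X1a X2b; split; lra.
(* If y stayed near P, x would be near S after time ta, and y2 would outgrow y3
   by time te. *)
pose ta := 4 * (2 - ln k); pose te := 3 * ta - Y1 0.
have te0 : 0 <= te by rewrite /te /ta /Y1; lra.
have [|||T [/andP[T0 _] YT YlT]] := first_exit (l := ln k) te0 cY1 cY2.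
- by rewrite /Y1; lra.
- by rewrite /Y2; lra.
- move=> hY.
  have ta0 : 0 <= ta by rewrite /ta; lra.
  have tae : ta <= te by rewrite /te /Y1; lra.
  have hX r : ta <= r <= te -> - X1 r <= ln k /\ X2 r - X1 r <= ln k.
    move=> /andP[tar rte]; have r0 := le_trans ta0 tar.
    have hYr q : 0 <= q <= r -> Y1 q <= ln k /\ Y2 q <= ln k.
      by move=> /andP[q0 qr]; apply: hY; rewrite q0 (le_trans qr).
    have [X1r X2r] := bulk r r0 hYr.
    by rewrite /ta in tar; split; lra.
  have := y_rates_near2 ef k0 (lexx k) O ta0 tae hX.
  have := y_rates_any ef O (lexx 0) ta0.
  have [|Yte _] := hY te; first by rewrite te0 lexx.
  rewrite -/Y1 -/Y2 subr0 => -[/andP[b1 _] _] [/andP[b2 _] _].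
  by rewrite -/Y1 in Y1b; rewrite /te in b2 Yte *; lra.
have [X1T X2T] := bulk T (ltW T0) YlT.
have [Y1T Y2T] : Y1 T <= ln k /\ Y2 T <= ln k by apply: YlT; rewrite (ltW T0) lexx.
have T10 : 10 <= T.
  have := y_rates_any ef O (lexx 0) (ltW T0).
  rewrite -/Y1 -/Y2 subr0 => -[/andP[_ b1] /andP[_ b2]].
  by rewrite -/Y1 -/Y2 in Y1b Y2b; case: YT => YT; lra.
have Z_any r : 0 <= r -> - 2 - 4 * r <= Z r.
  move=> r0; have := y_rates_any ef O (lexx 0) r0.
  rewrite -/Y1 -/Y2 subr0 => -[/andP[_ b1] /andP[b2 _]].
  by rewrite -/Z ZE in Zab; rewrite ZE; lra.
have ZT : - C <= Z T.
  have [Ttc|/ltW tcT] := leP T tc.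
    by apply: le_trans (Z_any T (ltW T0)); rewrite /C; lra.
  apply: (@le_trans _ _ (Z tc)).
    by apply: le_trans (Z_any tc tc0); rewrite /C; lra.
  rewrite -subr_ge0.
  have dZ r : tc <= r <= T -> is_derive r 1 Z
       ((- 2 * x3 r + (1 + f) * x1 r + (1 - f) * x2 r)) /\
     0 <= - 2 * x3 r + (1 + f) * x1 r + (1 - f) * x2 r <= 4.
    move=> /andP[tcr rT]; have r0 := le_trans tc0 tcr.
    have [p1 p2 p3 p] := player_orbit_simplex r0 O.1.
    split.
      by have [] := player_log_ratio r0 (player_orbit_rot O.2).
    have hYr q : 0 <= q <= r -> Y1 q <= ln k /\ Y2 q <= ln k.
      by move=> /andP[q0 qr]; apply: YlT; rewrite q0 (le_trans qr).
    have [X1r _] := bulk r r0 hYr.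
    have x32 : x3 r <= (1 - f) / 2 * x2 r.
      apply: ratio_le_of_ln => //.
      by move: X1r; rewrite /X1 /log_ratio /tc in tcr *; lra.
    have ? : 0 <= (1 + f) * x1 r by rewrite mulr_ge0 //; lra.
    have ? : (1 + f) * x1 r <= 2 * x1 r by rewrite ler_pM2r //; lra.
    have ? : (1 - f) * x2 r <= 1 * x2 r by rewrite ler_pM2r //; lra.
    by apply/andP; split; lra.
  by have /andP[] := rate_bounds tcT dZ; rewrite mul0r.
have [q1 q2 q3 q] := player_orbit_simplex (ltW T0) O.2.
have [p1 p2 p3 p] := player_orbit_simplex (ltW T0) O.1.
have [y1k y2k] := y_small3 k0 O (ltW T0) Y1T Y2T.
have y3T : 1 / 4 <= y3 T by move: y1k y2k; rewrite /k; lra.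
exists T => //; split => //.
  have Y2C : ln k - C <= Y2 T.
    by rewrite ZE in ZT; case: YT => YT; rewrite /C in ZT *; lra.
  have : expR (ln k - C) * y3 T <= y1 T.
    rewrite -ler_ln ?posrE ?mulr_gt0 ?expR_gt0 // lnM ?posrE ?expR_gt0 // expRK.
    by move: Y2C; rewrite /Y2 /log_ratio; lra.
  apply: le_trans; rewrite ler_pM2l ?expR_gt0 //.
  lra.
have : x3 T <= 1 * x2 T.
  apply: ratio_le_of_ln => //; rewrite ln1.
  by move: X1T; rewrite /X1 /log_ratio; lra.
lra.
Qed.

End Iteration.

(** * From the flow to positive replicator orbits *)

Section Flow.
Context {R : realType}.
Implicit Types (s t : R).

(** Componentwise differentiation, from the continuity of the projection
    applied to the difference quotients. *)
Lemma is_derive_fst (V W : normedModType R) (F : R -> V * W) t v w :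
  is_derive t 1 F (v, w) -> is_derive t 1 (fun r => (F r).1) v.
Proof.
move=> [dF FE].
have cF : (fun h => h^-1 *: ((F \o shift t) (h *: 1) - F t)) @ 0^' --> (v, w).
  by rewrite -FE; exact: dF.
have c1 : (fst \o (fun h => h^-1 *: ((F \o shift t) (h *: 1) - F t))) @ 0^' --> v.
  by apply: cvg_comp; [exact: cF | exact: cvg_fst].
apply: DeriveDef; first by apply/cvg_ex; exists v.
by rewrite /derive; apply: cvg_lim => //; exact: norm_hausdorff.
Qed.

Lemma is_derive_snd (V W : normedModType R) (F : R -> V * W) t v w :
  is_derive t 1 F (v, w) -> is_derive t 1 (fun r => (F r).2) w.
Proof.
move=> [dF FE].
have cF : (fun h => h^-1 *: ((F \o shift t) (h *: 1) - F t)) @ 0^' --> (v, w).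
  by rewrite -FE; exact: dF.
have c1 : (snd \o (fun h => h^-1 *: ((F \o shift t) (h *: 1) - F t))) @ 0^' --> w.
  by apply: cvg_comp; [exact: cF | exact: cvg_snd].
apply: DeriveDef; first by apply/cvg_ex; exists w.
by rewrite /derive; apply: cvg_lim => //; exact: norm_hausdorff.
Qed.

Definition mean_payoff (e x1 x2 x3 y1 y2 y3 : R) : R :=
  x1 * (e * y1 + y2 - y3) + x2 * (- y1 + e * y2 + y3) +
  x3 * (y1 - y2 + e * y3).

Lemma replicator_rsp (e a b c d : R) (x := mixed a b) (y := mixed c d) :
  let g := mean_payoff e a b (1 - a - b) c d (1 - c - d) in
  replicator (rsp_mx e) x y 0 = a * (e * c + d - (1 - c - d) - g) /\
  replicator (rsp_mx e) x y 1 = b * (- c + e * d + (1 - c - d) - g).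
Proof.
rewrite /replicator /x /y /mean_payoff; split;
by rewrite !mxE !big_ord_recl !big_ord0 !mxE !big_ord_recl !big_ord0 !mxE /=; field.
Qed.

(** The function x(r) exp(2 r) is nondecreasing, so x cannot reach 0 in
    finite time. *)
Lemma exp_growth_pos (x g : R -> R) (t : R) : 0 <= t ->
  (forall r, 0 <= r <= t -> [/\ is_derive r 1 x (x r * g r), 0 <= x r <= 1 & -2 <= g r <= 2]) ->
  0 < x 0 -> 0 < x t.
Proof.
move=> t0 H x0.
pose F r := x r * expR (2 * r).
have : x 0 <= F t.
  rewrite -subr_ge0.
  have -> : x 0 = F 0 by rewrite /F mulr0 expR0 mulr1.
  have dF r : 0 <= r <= t -> is_derive r 1 F ((x r * g r + 2 * x r) * expR (2 * r)) /\
     0 <= (x r * g r + 2 * x r) * expR (2 * r) <= 4 * expR (2 * t).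
    move=> rt; have [dx /andP[x0' x1] /andP[g1 g2]] := H r rt; split.
      have de : is_derive r 1 (fun q : R => expR (2 * q)) (expR (2 * r) * 2).
        have : is_derive r 1 (fun q : R => 2 * q) 2.
          have := @is_deriveZ R R R id 2 r 1 1 (is_derive_id _ _).
          by move=> /is_derive_eq; apply; rewrite /GRing.scale /= mulr1.
        by move=> d2; exact: (is_derive1_comp (is_derive_expR (2 * r)) d2).
      have := is_deriveM dx de => /is_derive_eq; apply.
      by rewrite /GRing.scale /=; ring.
    have xg : 0 <= x r * (g r + 2) <= 4 by apply/andP; split; nra.
    have -> : x r * g r + 2 * x r = x r * (g r + 2) by ring.
    have /andP[xg0 xg4] := xg; rewrite mulr_ge0 ?expR_ge0 //=.
    by apply: ler_pM; rewrite ?expR_ge0 // ler_expR ler_pM2l //; case/andP: rt.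
  by have /andP[] := rate_bounds t0 dF; rewrite mul0r.
by move=> /(lt_le_trans x0); rewrite /F pmulr_lgt0 ?expR_gt0.
Qed.

(** All six coordinates, the eliminated ones included: x1, x2, x3, y1, y2,
    y3. *)
Definition coord (i : nat) (p : state R) : R :=
  nth 0 [:: p.1.1.1; p.1.1.2; 1 - p.1.1.1 - p.1.1.2; p.1.2; p.2; 1 - p.1.2 - p.2] i.

Definition positive_state (p : state R) : Prop :=
  [/\ 0 < coord 0 p, 0 < coord 1 p & 0 < coord 2 p] /\
  [/\ 0 < coord 3 p, 0 < coord 4 p & 0 < coord 5 p].

Lemma mean_payoff_bound (e a b c d : R) : -1 < e < 1 -> 0 <= a -> 0 <= b ->
  a + b <= 1 -> 0 <= c -> 0 <= d -> c + d <= 1 ->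
  -1 <= mean_payoff e a b (1 - a - b) c d (1 - c - d) <= 1.
Proof.
move=> /andP[e1 e2] a0 b0 ab c0 d0 cd; rewrite /mean_payoff.
have ec x : 0 <= x -> - x <= e * x <= x by move=> x0; apply/andP; split; nra.
have [/andP[? ?] /andP[? ?]] := (ec c c0, ec d d0).
have /ec/andP[? ?] : 0 <= 1 - c - d by lra.
have weigh (x f : R) : 0 <= x -> -1 <= f -> f <= 1 -> - x <= x * f <= x.
  by move=> x0 f1 f2; apply/andP; split; nra.
have /andP[? ?] := weigh a (e * c + d - (1 - c - d)) a0 ltac:(lra) ltac:(lra).
have /andP[? ?] := weigh b (- c + e * d + (1 - c - d)) b0 ltac:(lra) ltac:(lra).
have /andP[? ?] := weigh (1 - a - b) (c - d + e * (1 - c - d)) ltac:(lra) ltac:(lra) ltac:(lra).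
by apply/andP; split; lra.
Qed.

(** The flow is known to remain in the simplex, so the payoffs are bounded
    and the coordinates stay positive. *)
Lemma player_orbit_of_field (e : R) (x1 x2 y1 y2 : R -> R) : -1 < e < 1 ->
  (forall t, [/\ 0 <= x1 t, 0 <= x2 t & x1 t + x2 t <= 1] /\
             [/\ 0 <= y1 t, 0 <= y2 t & y1 t + y2 t <= 1]) ->
  (forall t, is_derive t 1 x1
      (replicator (rsp_mx e) (mixed (x1 t) (x2 t)) (mixed (y1 t) (y2 t)) 0) /\
    is_derive t 1 x2
      (replicator (rsp_mx e) (mixed (x1 t) (x2 t)) (mixed (y1 t) (y2 t)) 1)) ->
  0 < x1 0 -> 0 < x2 0 -> 0 < 1 - x1 0 - x2 0 ->
  player_orbit e x1 x2 (fun t => 1 - x1 t - x2 t)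
    y1 y2 (fun t => 1 - y1 t - y2 t).
Proof.
move=> e1 simplex field p1 p2 p3.
pose g t := mean_payoff e (x1 t) (x2 t) (1 - x1 t - x2 t)
  (y1 t) (y2 t) (1 - y1 t - y2 t).
have d1 t : is_derive t 1 x1
    (x1 t * (e * y1 t + y2 t - (1 - y1 t - y2 t) - g t)).
  by have [<- _] := replicator_rsp e (x1 t) (x2 t) (y1 t) (y2 t); case: (field t).
have d2 t : is_derive t 1 x2
    (x2 t * (- y1 t + e * y2 t + (1 - y1 t - y2 t) - g t)).
  by have [_ <-] := replicator_rsp e (x1 t) (x2 t) (y1 t) (y2 t); case: (field t).
have d3 t : is_derive t 1 (fun t => 1 - x1 t - x2 t)
    ((1 - x1 t - x2 t) * (y1 t - y2 t + e * (1 - y1 t - y2 t) - g t)).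
  have := is_deriveB (is_deriveB (is_derive_cst (1 : R) t 1) (d1 t)) (d2 t).
  by move=> /is_derive_eq; apply; rewrite /g /mean_payoff; ring.
have gb t : -1 <= g t <= 1.
  by have [[? ? ?] [? ? ?]] := simplex t; exact: mean_payoff_bound.
exists g => t t0.
have yb r : [/\ - y1 r <= e * y1 r <= y1 r, - y2 r <= e * y2 r <= y2 r &
   - (1 - y1 r - y2 r) <= e * (1 - y1 r - y2 r) <= 1 - y1 r - y2 r].
  have [_ [? ? ?]] := simplex r; have /andP[? ?] := e1.
  by split; apply/andP; split; nra.
split; last by split; [exact: d1|exact: d2|exact: d3].
split.
- apply: (exp_growth_pos (g := fun r => e * y1 r + y2 r -
    (1 - y1 r - y2 r) - g r) t0 _ p1) => r _; split; first exact: d1.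
    by have [[? ? ?] _] := simplex r; apply/andP; split; lra.
  have [/andP[? ?] /andP[? ?] /andP[? ?]] := yb r; have /andP[? ?] := gb r.
  by have [_ [? ? ?]] := simplex r; apply/andP; split; lra.
- apply: (exp_growth_pos (g := fun r => - y1 r + e * y2 r +
    (1 - y1 r - y2 r) - g r) t0 _ p2) => r _; split; first exact: d2.
    by have [[? ? ?] _] := simplex r; apply/andP; split; lra.
  have [/andP[? ?] /andP[? ?] /andP[? ?]] := yb r; have /andP[? ?] := gb r.
  by have [_ [? ? ?]] := simplex r; apply/andP; split; lra.
- apply: (exp_growth_pos (x := fun r => 1 - x1 r - x2 r)
    (g := fun r => y1 r - y2 r +
    e * (1 - y1 r - y2 r) - g r) t0 _ p3) => r _; split; first exact: d3.
    by have [[? ? ?] _] := simplex r; apply/andP; split; lra.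
  have [/andP[? ?] /andP[? ?] /andP[? ?]] := yb r; have /andP[? ?] := gb r.
  by have [_ [? ? ?]] := simplex r; apply/andP; split; lra.
- by ring.
Qed.

Lemma flow_orbit (eX eY : R) phi p : -1 < eX < 1 -> -1 < eY < 1 ->
  rsp_flow eX eY phi -> Delta p -> positive_state p ->
  let c i t := coord i (phi t p) in
  rsp_orbit eX eY (c 0) (c 1) (c 2) (c 3) (c 4) (c 5).
Proof.
move=> hX hY flow Dp [[p1 p2 p3] [q1 q2 q3]] c.
have [phi0 phiD] := flow p Dp.
have c0 i : c i 0 = coord i p by rewrite /c phi0.
have simplex t : [/\ 0 <= c 0 t, 0 <= c 1 t & c 0 t + c 1 t <= 1] /\
             [/\ 0 <= c 3 t, 0 <= c 4 t & c 3 t + c 4 t <= 1].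
  have [+ _] := phiD t; rewrite /c /coord /Delta /=.
  by case: (phi t p) => [[[? ?] ?] ?].
have fieldE t : is_derive t 1 (phi^~ p)
    (replicator (rsp_mx eX) (mixed (c 0 t) (c 1 t)) (mixed (c 3 t) (c 4 t)) 0,
     replicator (rsp_mx eX) (mixed (c 0 t) (c 1 t)) (mixed (c 3 t) (c 4 t)) 1,
     replicator (rsp_mx eY) (mixed (c 3 t) (c 4 t)) (mixed (c 0 t) (c 1 t)) 0,
     replicator (rsp_mx eY) (mixed (c 3 t) (c 4 t)) (mixed (c 0 t) (c 1 t)) 1).
  have [_] := phiD t; rewrite /c /coord /=.
  by case: (phi t p) => [[[? ?] ?] ?].
split; apply: player_orbit_of_field; rewrite ?c0 //.
- move=> t; have d := is_derive_fst (is_derive_fst (fieldE t)).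
  by split; [exact: is_derive_fst d|exact: is_derive_snd d].
- by move=> t; have [? ?] := simplex t.
- move=> t; split; last exact: is_derive_snd (fieldE t).
  exact: is_derive_snd (is_derive_fst (fieldE t)).
Qed.

End Flow.

(** * The cycles and their edges *)

Section Cycles.
Context {R : realType}.
Implicit Types (p q v w : state R) (k s : R).

Lemma next_nth_uniq (T : eqType) (x : T) (c : seq T) (i : nat) : uniq c ->
  (i < size c)%N -> next c (nth x c i) = nth x c (i.+1 %% size c).
Proof.
move=> Uc ic; rewrite next_nth mem_nth // index_uniq //.
case: c ic Uc => // y c /= ic _.
have [->|ic'] := eqVneq i (size c); first by rewrite modnn nth_default.
by rewrite modn_small //= ?ltnS 1?ltn_neqAle ?ic' //; apply: set_nth_default; rewrite ltn_neqAle ic'.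
Qed.

Definition on_segment v w : set (state R) :=
  [set q | exists2 s : R, 0 <= s <= 1 & q = (1 - s) *: v + s *: w].

(** With closed segments the vertices need no separate treatment. *)
Lemma cycle_ofE c : uniq c -> cycle_of c =
  [set q | exists2 i, (i < size c)%N &
     on_segment (nth 0 c i) (nth 0 c (i.+1 %% size c)) q].
Proof.
move=> Uc; apply/seteqP; split=> q /=.
  case=> [qc|[v vc [s /andP[s0 s1] qE]]].
    exists (index q c); first by rewrite index_mem.
    by exists 0; rewrite ?lexx ?ler01 // nth_index // subr0 scale1r scale0r addr0.
  exists (index v c); first by rewrite index_mem.
  exists s; first by rewrite !ltW.
  by rewrite -next_nth_uniq ?index_mem // nth_index.
move=> [i ic [s /andP[s0 s1] qE]].
have [s0'|s0'] := eqVneq s 0.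
  by left; rewrite qE s0' subr0 scale1r scale0r addr0 /= mem_nth.
have [s1'|s1'] := eqVneq s 1.
  left; rewrite qE s1' subrr scale0r scale1r add0r /= mem_nth // ltn_mod.
  by case: (size c) ic.
right; exists (nth 0 c i); first exact: mem_nth.
exists s; last by rewrite next_nth_uniq.
by rewrite !lt_neqAle s0 s1 s1' eq_sym s0'.
Qed.

(** Exchanging the players maps C1 to C2 together with the direction of
    travel. *)
Definition swap_players p : state R := (p.1.2, p.2, p.1.1.1, p.1.1.2).

Lemma swap_playersK : involutive swap_players.
Proof. by case=> [[[? ?] ?] ?]. Qed.

Lemma on_segment_swap v w q :
  on_segment (swap_players v) (swap_players w) q = on_segment v w (swap_players q).
Proof.
apply/propext; split=> -[s s01 qE]; exists s => //.
  by rewrite qE; case: v {qE} => [[[? ?] ?] ?]; case: w => [[[? ?] ?] ?].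
by rewrite -[q]swap_playersK qE; case: v {qE} => [[[? ?] ?] ?]; case: w => [[[? ?] ?] ?].
Qed.

Definition vertices1 : seq (state R) :=
  [:: vertex Pa Pa; vertex Sc Pa; vertex Sc Sc;
      vertex Rk Sc; vertex Rk Rk; vertex Pa Rk].

Lemma vertices1_uniq : uniq vertices1.
Proof.
rewrite /vertices1 /vertex /Pa /Sc /Rk /= !inE !xpair_eqE.
by rewrite !(eqxx, oner_eq0, eq_sym 0 1) /= ?(eqxx, oner_eq0).
Qed.

Lemma C2_swap q : C2 q = C1 (swap_players q).
Proof.
have E : C2 = cycle_of [seq swap_players v | v <- vertices1] by [].
rewrite /C1 -/vertices1 E !cycle_ofE ?vertices1_uniq ?map_inj_uniq ?vertices1_uniq //; last first.
  exact: inv_inj swap_playersK.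
apply/propext; split=> -[i]; rewrite ?size_map => i6.
  by rewrite !(nth_map 0) ?ltn_mod // on_segment_swap; exists i.
by rewrite -on_segment_swap => h; exists i; rewrite ?size_map // !(nth_map 0) ?ltn_mod.
Qed.

Definition near_cycle k p : bool :=
  near_edges k (coord 0 p) (coord 1 p) (coord 2 p)
               (coord 3 p) (coord 4 p) (coord 5 p).

Lemma segment_coords s v w : (1 - s) *: v + s *: w =
  ((1 - s) * v.1.1.1 + s * w.1.1.1, (1 - s) * v.1.1.2 + s * w.1.1.2,
   (1 - s) * v.1.2 + s * w.1.2, (1 - s) * v.2 + s * w.2).
Proof. by case: v => [[[? ?] ?] ?]; case: w => [[[? ?] ?] ?]. Qed.

(** A point of the state space is on an edge exactly when the three
    coordinates listed for this edge vanish; the parameter along the edge is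
    one of the other coordinates or its complement to 1. *)
Lemma C1P p : C1 p <-> Delta p /\ near_cycle 0 p.
Proof.
rewrite /C1 -/vertices1 cycle_ofE ?vertices1_uniq //; split.
  move=> [i i6 [s /andP[s0 s1] ->]]; rewrite segment_coords.
  split; last apply/(has_nthP (0, 0, 0)); first by
    case: i i6 => [|[|[|[|[|[|//]]]]]] _ /=; split; split; lra.
  exists i => //.
  by case: i i6 => [|[|[|[|[|[|//]]]]]] _; rewrite /coord /=; apply/and3P; split; lra.
case: p => [[[a b] c] d] [[[a0 b0 ab] [c0 d0 cd]]].
move=> /(has_nthP (0, 0, 0))[i i6] h; exists i => //; move: i i6 h.
have seg (x y z t x' y' z' t' : R) : x = x' -> y = y' -> z = z' -> t = t' ->
  (x, y, z, t) = (x', y', z', t') by move=> -> -> -> ->.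
case=> [|[|[|[|[|[|//]]]]]] _; rewrite /coord /= => /and3P[h1 h2 h3];
  [exists b|exists d|exists a|exists c|exists (1 - a)|exists (1 - c)];
  rewrite ?segment_coords /=; by [apply/andP; split; lra|apply: seg; lra].
Qed.

End Cycles.

(** * Neighbourhoods of the cycles and limit sets *)

Section Topology.
Context {R : realType}.
Implicit Types (p q v w : state R) (c : nat * nat * nat) (k s : R) (b : bool).

Definition cycle_choice b : set (state R) := if b then C2 else C1.
Definition relabel b p : state R := if b then swap_players p else p.

Lemma Delta_relabel b p : Delta (relabel b p) <-> Delta p.
Proof. by case: b => //; case: p => [[[? ?] ?] ?]; split=> -[? ?]; split. Qed.

Lemma cycle_choiceP b q :
  cycle_choice b q <-> Delta q /\ near_cycle 0 (relabel b q).
Proof.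
by rewrite -(Delta_relabel b); case: b => /=; rewrite ?C2_swap C1P.
Qed.

Lemma continuous_coord i : continuous (@coord R i).
Proof.
have cf (T U : topologicalType) : continuous (@fst T U).
  by move=> x; exact: cvg_fst.
have cs (T U : topologicalType) : continuous (@snd T U).
  by move=> x; exact: cvg_snd.
have comp (T U V : topologicalType) (f : T -> U) (g : U -> V) :
    continuous f -> continuous g -> continuous (fun x => g (f x)).
  by move=> hf hg x; exact: continuous_comp (hf x) (hg (f x)).
have c11 : continuous (fun p => p.1.1) := comp _ _ _ _ _ (cf _ _) (cf _ _).
have c1 : continuous (fun p => p.1.1.1) := comp _ _ _ _ _ c11 (cf _ _).
have c2 : continuous (fun p => p.1.1.2) := comp _ _ _ _ _ c11 (cs _ _).
have c3 : continuous (fun p => p.1.2) := comp _ _ _ _ _ (cf _ _) (cs _ _).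
have c4 : continuous (fun p => p.2) by exact: cs.
have c0 (f g : state R -> R) : continuous f -> continuous g ->
    continuous (fun p => 1 - f p - g p).
  by move=> hf hg p; apply: cvgB; [apply: cvgB; [exact: cvg_cst|exact: hf]|exact: hg].
case: i => [|[|[|[|[|[|i]]]]]] //; rewrite /coord /=; try exact: c0.
by rewrite nth_nil; move=> p; exact: cvg_cst.
Qed.

Lemma closed_coord_le i k : closed [set p | coord i p <= k].
Proof.
apply: (@preimage_closed _ _ (@coord R i) [set x | x <= k]); last exact: closed_le.
by move=> p _; exact: continuous_coord.
Qed.

Lemma closed_coord_ge i k : closed [set p | k <= coord i p].
Proof.
apply: (@preimage_closed _ _ (@coord R i) [set x | k <= x]); last exact: closed_ge.
by move=> p _; exact: continuous_coord.
Qed.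

Definition swap_coord b (i : nat) : nat := if b then nth i [:: 3; 4; 5; 0; 1; 2]%N i else i.

Lemma coord_relabel b i p : coord i (relabel b p) = coord (swap_coord b i) p.
Proof. by case: b => //; case: i => [|[|[|[|[|[|[|i]]]]]]]. Qed.

Definition edge_coords : seq (nat * nat * nat) :=
  [:: (3, 4, 0); (2, 0, 3); (5, 3, 2); (1, 2, 5); (4, 5, 1); (0, 1, 4)]%N.

Definition near_edge k (c : nat * nat * nat) p : bool :=
  [&& coord c.1.1 p <= k, coord c.1.2 p <= k & coord c.2 p <= k].

Lemma near_cycleE k p : near_cycle k p = has (fun c => near_edge k c p) edge_coords.
Proof. by []. Qed.

Lemma near_cycleW k k' p : k <= k' -> near_cycle k p -> near_cycle k' p.
Proof. exact: near_edgesW. Qed.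

Lemma closed_near_cycle b k : closed [set p | near_cycle k (relabel b p)].
Proof.
have -> : [set p | near_cycle k (relabel b p)] =
    [set p | has (fun c => near_edge k c (relabel b p)) edge_coords] by [].
elim: edge_coords => [|c l IHl] /=.
  by have -> : [set p : state R | false] = set0; [apply/seteqP; split | exact: closed0].
have -> : [set p | near_edge k c (relabel b p) ||
    has (fun c0 => near_edge k c0 (relabel b p)) l] =
  ([set p | coord (swap_coord b c.1.1) p <= k] `&`
   ([set p | coord (swap_coord b c.1.2) p <= k] `&`
    [set p | coord (swap_coord b c.2) p <= k])) `|`
  [set p | has (fun c0 => near_edge k c0 (relabel b p)) l].
  apply/seteqP; split=> p /=; rewrite /near_edge !coord_relabel.
    by move=> /orP[/and3P[? ? ?]|?]; [left|right].
  by move=> [[? [? ?]]|?]; apply/orP; [left; apply/and3P|right].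
by apply: closedU => //; do 2?[apply: closedI]; exact: closed_coord_le.
Qed.

(** Finitely many edges: if each one failed for some k, the smallest of these
    values would violate the hypothesis. *)
Lemma near_cycle_lim p : (forall k, 0 < k -> near_cycle k p) -> near_cycle 0 p.
Proof.
rewrite near_cycleE => H; have {}H k : 0 < k ->
  has (fun c => near_edge k c p) edge_coords by move=> /H.
elim: edge_coords H => [|c l IHl] H; first by have := H 1 ltr01.
rewrite [has _ _]/=; apply/orP.
have [h|] := pselect (forall k, 0 < k -> near_edge k c p).
  left; rewrite /near_edge.
  by apply/and3P; split; apply/ler_addgt0Pl => k /h /and3P[]; rewrite addr0.
move=> /existsNP[k0 /not_implyP[k00 nc]]; right; apply: IHl => k k_gt0.
have /H : 0 < Num.min k k0 by rewrite lt_min k_gt0.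
move=> /orP[|].
  move=> /and3P[h1 h2 h3]; case: nc; move: h1 h2 h3; rewrite !le_min.
  by move=> /andP[_ h1] /andP[_ h2] /andP[_ h3]; apply/and3P.
apply: sub_has => d /and3P[]; rewrite !le_min.
by move=> /andP[h1 _] /andP[h2 _] /andP[h3 _]; apply/and3P.
Qed.

Lemma closed_Delta : closed (@Delta R).
Proof.
have -> : @Delta R = [set p | 0 <= coord 0 p] `&` [set p | 0 <= coord 1 p] `&`
    [set p | 0 <= coord 2 p] `&` [set p | 0 <= coord 3 p] `&`
    [set p | 0 <= coord 4 p] `&` [set p | 0 <= coord 5 p].
  apply/seteqP; split=> -[[[x1 x2] y1] y2]; rewrite /Delta /coord /=.
    by move=> [[? ? ?] [? ? ?]]; do 5?split => //; lra.
  by move=> [[[[[? ?] ?] ?] ?] ?]; split; split=> //; lra.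
by do 5?[apply: closedI]; exact: closed_coord_ge.
Qed.

Lemma compact_Delta : compact (@Delta R).
Proof.
apply: (@subclosed_compact _ (@Delta R) (`[0, 1] `*` `[0, 1] `*` `[0, 1] `*` `[0, 1])).
- exact: closed_Delta.
- by do 3?[apply: compact_setX]; exact: segment_compact.
move=> [[[x1 x2] y1] y2] [[? ? ?] [? ? ?]].
by do 3?split => //=; rewrite in_itv /=; apply/andP; split; lra.
Qed.

(** Compactness of the state space. Near a point of the cycle the given
    neighbourhood contains everything; near any other point the condition
    fails for small k because it is closed. *)
Lemma near_cycle_nbhd b U : nbhd (cycle_choice b) U ->
  exists2 k, 0 < k & forall p, Delta p -> near_cycle k (relabel b p) -> U p.
Proof.
move=> [W CW ->].
have /compact_near_coveringP cov := compact_Delta.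
have covk : \forall k \near (0 : R)^'+,
    @Delta R `<=` [set p | near_cycle k (relabel b p) -> W p].
  apply: cov => p Dp; have [pC|pC] := pselect (cycle_choice b p).
    have Wp : nbhs p W by exact: CW.
    exists (W, setT); first by split => //; exact: filterT.
    by case=> q k /= [].
  have [k k0 npk] : exists2 k, 0 < k & ~ near_cycle k (relabel b p).
    apply: contrapT => /forall2NP h; apply: pC; apply/cycle_choiceP; split=> //.
    by apply: near_cycle_lim => k k0; have [|/contrapT] := h k.
  exists (~` [set q | near_cycle k (relabel b q)], [set k' | k' <= k]).
    split; last by near=> k'; apply: ltW; near: k'; exact: nbhs_right_lt.
    by apply: open_nbhs_nbhs; split=> //; rewrite openC; exact: closed_near_cycle.
  by case=> q k' /= [nq k'k] /(near_cycleW k'k) /nq.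
near (0 : R)^'+ => k.
exists k; first by near: k; exact: nbhs_right_gt.
have hk : @Delta R `<=` [set p | near_cycle k (relabel b p) -> W p] by near: k.
by move=> p Dp pk; split=> //; exact: hk.
Unshelve. all: by end_near. Qed.

(** The state space and the sets of points near the cycle are closed, hence
    contain the limit points of orbits that are eventually in them. *)
Lemma omega_limit_near b (phi : R -> state R -> state R) p :
  (forall t, Delta (phi t p)) ->
  (forall k, 0 < k -> exists T, forall t, T <= t -> near_cycle k (relabel b (phi t p))) ->
  omega_limit phi p `<=` cycle_choice b.
Proof.
move=> pD pk q; rewrite /omega_limit clusterE => qc.
have closed_in (A : set (state R)) T : closed A -> (forall t, T <= t -> A (phi t p)) -> A q.
  move=> cA hA; rewrite (closure_id A).1 //; apply: qc.
  by exists T; split; [exact: num_real|move=> t /ltW; exact: hA].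
apply/cycle_choiceP; split; first by apply: (closed_in _ 0 closed_Delta).
apply: near_cycle_lim => k /pk[T hT].
exact: (closed_in _ T (@closed_near_cycle b k) hT).
Qed.

End Topology.

(** * Boxes near the middle of an edge *)

Section Boxes.
Context {R : realType}.
Implicit Types (p q : state R) (b : bool) (k s : R).

Lemma relabelK b : involutive (@relabel R b).
Proof. by case: b => // p; exact: swap_playersK. Qed.

Lemma eucl_dist_relabel b p q : eucl_dist (relabel b p) (relabel b q) = eucl_dist p q.
Proof.
case: b => //; case: p => [[[? ?] ?] ?]; case: q => [[[? ?] ?] ?] /=.
by congr Num.sqrt; ring.
Qed.

Lemma tube_of_cycle_point b (e : R) p q : Delta p -> Delta q -> near_cycle 0 q ->
  eucl_dist (relabel b p) q < e -> tube (cycle_choice b) e p.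
Proof.
move=> Dp Dq nq pq; split=> //; apply: le_lt_trans pq.
rewrite /set_dist -[q](relabelK b) eucl_dist_relabel; apply: ge_inf.
  by exists 0 => _ [r _ <-]; case: p {Dp} => [[[? ?] ?] ?]; case: r => [[[? ?] ?] ?]; exact: sqrtr_ge0.
exists (relabel b q) => //; apply/cycle_choiceP; rewrite relabelK; split=> //.
by apply/Delta_relabel.
Qed.

Lemma coord_close_swap (r : R) p q :
  coord_close r (swap_players p) (swap_players q) <-> coord_close r p q.
Proof. by case: p => [[[? ?] ?] ?]; case: q => [[[? ?] ?] ?]; split=> -[]. Qed.

Lemma coord_close_vertices1 i : (i < 6)%N ->
  coord_close 1 (nth 0 (@vertices1 R) i) (nth 0 vertices1 (i.+1 %% 6)).
Proof.
by case: i => [|[|[|[|[|[|//]]]]]] _; split=> /=; 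
  rewrite ?(subrr, subr0, sub0r, normrN, normr0, normr1) ?ler01.
Qed.

Lemma leb4_tube_cycle_choice b (e : R) : 0 < e <= 1 ->
  (leb4 (tube (cycle_choice b) e) <= (768 * 6 * e ^+ 3)%:E)%E.
Proof.
move=> he; case: b; last first.
  apply: (@leb4_tube_cycle R vertices1) => // v vc.
  rewrite -(nth_index 0 vc) next_nth_uniq ?vertices1_uniq ?index_mem //.
  by apply: coord_close_vertices1; rewrite -index_mem in vc.
apply: (@leb4_tube_cycle R (map swap_players vertices1)) => // v vc.
have Uc : uniq (map (@swap_players R) vertices1).
  by rewrite map_inj_uniq ?vertices1_uniq //; exact: inv_inj swap_playersK.
have ic : (index v (map swap_players vertices1) < 6)%N by rewrite -index_mem in vc.
rewrite -(nth_index 0 vc) next_nth_uniq // !(nth_map 0) ?ltn_mod //.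
by apply/coord_close_swap; exact: coord_close_vertices1.
Qed.

Lemma relabel_rect b (I1 I2 I3 I4 : set R) : relabel b @^-1` rect I1 I2 I3 I4 =
  if b then rect I3 I4 I1 I2 else rect I1 I2 I3 I4.
Proof.
by case: b => //; apply/seteqP; split=> -[[[? ?] ?] ?] [[[? ?] ?] ?] //=; do 3?split.
Qed.

(** The tube has volume O(e ^ 3), and a box with three sides proportional to
    e and one fixed side has volume of exactly this order. *)
Lemma full_density_meets_rect b N (a1 b1 a2 b2 a3 b3 a4 b4 : R -> R) k : 0 < k ->
  (forall e, 0 < e <= 1 / 10 ->
    [/\ a1 e <= b1 e, a2 e <= b2 e, a3 e <= b3 e & a4 e <= b4 e] /\
    (b1 e - a1 e) * (b2 e - a2 e) * (b3 e - a3 e) * (b4 e - a4 e) = k * e ^+ 3 /\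
    relabel b @^-1` rect `[a1 e, b1 e] `[a2 e, b2 e] `[a3 e, b3 e] `[a4 e, b4 e]
      `<=` tube (cycle_choice b) e) ->
  full_density (cycle_choice b) N ->
  \forall e \near 0^'+, exists2 p, N p &
    rect `[a1 e, b1 e] `[a2 e, b2 e] `[a3 e, b3 e] `[a4 e, b4 e] (relabel b p).
Proof.
move=> k0 H dens.
pose B e : set (state R) := relabel b @^-1`
  rect `[a1 e, b1 e] `[a2 e, b2 e] `[a3 e, b3 e] `[a4 e, b4 e].
suff : \forall e \near 0^'+, (N `&` B e) !=set0.
  by apply: filterS => e [p [Np Bp]]; exists p.
apply: (full_density_meets (C := 768 * 6) k0 _ dens).
near=> e.
have e0 : 0 < e by near: e; exact: nbhs_right_gt.
have e1 : e <= 1 / 10 by near: e; apply: nbhs_right_le; lra.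
have [|[h1 h2 h3 h4] [vol Bt]] := H e; first by rewrite e0.
split=> //.
- by rewrite /B relabel_rect; case: (b); apply: rect_caratheodory; exact: measurable_itv.
- rewrite -vol /B relabel_rect; case: (b); rewrite leb4_rect // lee_fin.
  by rewrite le_eqVlt; apply/orP; left; apply/eqP; ring.
- by apply: leb4_tube_cycle_choice; rewrite e0; lra.
Unshelve. all: by end_near. Qed.

(** Points near the middle of the edge from (P, R) to (P, P) at distance of
    order e from it. *)
Definition stay_box (e : R) : set (state R) :=
  rect `[e / 4, e / 2] `[e / 4, e / 2] `[2 / 5, 3 / 5] `[e / 4, e / 2].

(** Points near the middle of the edge from (P, P) to (S, P) at distance of
    order e from it. *)
Definition leave_box (e : R) : set (state R) :=
  rect `[e / 4, e / 2] `[2 / 5, 3 / 5] `[e / 4, e / 2] `[e / 4, e / 2].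

Lemma stay_boxP (e : R) p : stay_box e p <->
  [/\ e / 4 <= coord 0 p <= e / 2, e / 4 <= coord 1 p <= e / 2,
      2 / 5 <= coord 3 p <= 3 / 5 & e / 4 <= coord 4 p <= e / 2].
Proof.
case: p => [[[x1 x2] y1] y2]; rewrite /stay_box /rect /coord /= !in_itv /=.
by split=> [[[[? ?] ?] ?]|[? ? ? ?]].
Qed.

Lemma leave_boxP (e : R) p : leave_box e p <->
  [/\ e / 4 <= coord 0 p <= e / 2, 2 / 5 <= coord 1 p <= 3 / 5,
      e / 4 <= coord 3 p <= e / 2 & e / 4 <= coord 4 p <= e / 2].
Proof.
case: p => [[[x1 x2] y1] y2]; rewrite /leave_box /rect /coord /= !in_itv /=.
by split=> [[[[? ?] ?] ?]|[? ? ? ?]].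
Qed.

Lemma coord_sum p : coord 2 p = 1 - coord 0 p - coord 1 p /\
  coord 5 p = 1 - coord 3 p - coord 4 p.
Proof. by []. Qed.

Lemma DeltaP p : Delta p <->
  [/\ 0 <= coord 0 p, 0 <= coord 1 p & 0 <= coord 2 p] /\
  [/\ 0 <= coord 3 p, 0 <= coord 4 p & 0 <= coord 5 p].
Proof.
case: p => [[[x1 x2] y1] y2]; rewrite /Delta /coord /=.
by split=> -[[? ? ?] [? ? ?]]; split; split; lra.
Qed.

Lemma stay_box_Delta (e : R) p : 0 < e <= 1 / 10 -> stay_box e p ->
  Delta p /\ positive_state p.
Proof.
move=> /andP[e0 e1] /stay_boxP[/andP[? ?] /andP[? ?] /andP[? ?] /andP[? ?]].
have [E2 E5] := coord_sum p; split; last by split; split; lra.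
by apply/DeltaP; split; split; lra.
Qed.

Lemma leave_box_Delta (e : R) p : 0 < e <= 1 / 10 -> leave_box e p ->
  Delta p /\ positive_state p.
Proof.
move=> /andP[e0 e1] /leave_boxP[/andP[? ?] /andP[? ?] /andP[? ?] /andP[? ?]].
have [E2 E5] := coord_sum p; split; last by split; split; lra.
by apply/DeltaP; split; split; lra.
Qed.

Lemma stay_box_tube b (e : R) : 0 < e <= 1 / 10 ->
  relabel b @^-1` stay_box e `<=` tube (cycle_choice b) e.
Proof.
move=> he p Bp; have [/Delta_relabel Dp _] := stay_box_Delta he Bp.
have /andP[e0 e1] := he.
move/stay_boxP: Bp; set q := relabel b p.
move=> [/andP[? ?] /andP[? ?] /andP[? ?] /andP[? ?]].
apply: (@tube_of_cycle_point b e p (0, 0, coord 3 q, 0)) => //.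
- by split; split; lra.
- by rewrite /near_cycle /near_edges /coord /= lexx !orbT.
rewrite -/q (_ : eucl_dist q (0, 0, coord 3 q, 0) =
  Num.sqrt (coord 0 q ^+ 2 + coord 1 q ^+ 2 + coord 4 q ^+ 2)); last first.
  by case: (q) => [[[? ?] ?] ?]; rewrite /eucl_dist /coord /=; congr Num.sqrt; ring.
rewrite -[ltRHS](ger0_norm (ltW e0)) -sqrtr_sqr ltr_sqrt ?exprn_gt0 //.
rewrite !expr2; nra.
Qed.

Lemma leave_box_tube b (e : R) : 0 < e <= 1 / 10 ->
  relabel b @^-1` leave_box e `<=` tube (cycle_choice b) e.
Proof.
move=> he p Bp; have [/Delta_relabel Dp _] := leave_box_Delta he Bp.
have /andP[e0 e1] := he.
move/leave_boxP: Bp; set q := relabel b p.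
move=> [/andP[? ?] /andP[? ?] /andP[? ?] /andP[? ?]].
apply: (@tube_of_cycle_point b e p (0, coord 1 q, 0, 0)) => //.
- by split; split; lra.
- by rewrite /near_cycle /near_edges /coord /= lexx.
rewrite -/q (_ : eucl_dist q (0, coord 1 q, 0, 0) =
  Num.sqrt (coord 0 q ^+ 2 + coord 3 q ^+ 2 + coord 4 q ^+ 2)); last first.
  by case: (q) => [[[? ?] ?] ?]; rewrite /eucl_dist /coord /=; congr Num.sqrt; ring.
rewrite -[ltRHS](ger0_norm (ltW e0)) -sqrtr_sqr ltr_sqrt ?exprn_gt0 //.
rewrite !expr2; nra.
Qed.

Lemma full_density_meets_stay_box b N : full_density (cycle_choice b) N ->
  \forall e \near 0^'+, exists2 p, N p & stay_box e (relabel b p).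
Proof.
apply: (full_density_meets_rect (k := 1 / 4 * (1 / 4) * (1 / 5) * (1 / 4))).
  by lra.
move=> e he; have /andP[e0 _] := he; split; first by split; lra.
by split; [field | exact: stay_box_tube].
Qed.

Lemma full_density_meets_leave_box b N : full_density (cycle_choice b) N ->
  \forall e \near 0^'+, exists2 p, N p & leave_box e (relabel b p).
Proof.
apply: (full_density_meets_rect (k := 1 / 4 * (1 / 4) * (1 / 5) * (1 / 4))).
  by lra.
move=> e he; have /andP[e0 _] := he; split; first by split; lra.
by split; [field | exact: leave_box_tube].
Qed.

Lemma log_sub_le (a c d : R) : 0 < a -> 0 < c -> 0 < d -> a <= d * c ->
  ln a - ln c <= d - 1.
Proof. by move=> a0 c0 d0 /(ln_le_addl a0 c0 d0); rewrite lerBlDl. Qed.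

Lemma log_sub_scale_le (e a c d : R) : 0 < e -> 0 < a -> 0 < c -> 0 < d ->
  e * a <= d * c -> ln a - ln c <= - ln e + (d - 1).
Proof.
move=> e0 a0 c0 d0 h; have := log_sub_le (mulr_gt0 e0 a0) c0 d0 h.
by rewrite lnM ?posrE // => ?; lra.
Qed.

Lemma log_sub_scale_ge (e a c d : R) : 0 < e -> 0 < a -> 0 < c -> 0 < d ->
  a <= d * (e * c) -> - ln e - (d - 1) <= ln c - ln a.
Proof.
move=> e0 a0 c0 d0 h; have := log_sub_le a0 (mulr_gt0 e0 c0) d0 h.
by rewrite lnM ?posrE // => ?; lra.
Qed.

(** Here u, v, w equal - ln e up to bounded terms, and the direction (1, 1,
    1) is inside the cone. *)
Lemma stay_box_cone (e L : R) (c : nat -> R -> R) p :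
  0 < e <= 1 / 10 -> 10 <= - ln e -> L <= - ln e -> stay_box e p ->
  (forall i, c i 0 = coord i p) ->
  in_cone L (c 0) (c 1) (c 2) (c 3) (c 4) (c 5) 0.
Proof.
move=> /andP[e0 e1] e10 Le /stay_boxP[/andP[? ?] /andP[? ?] /andP[? ?] /andP[? ?]] cE.
have [E2 E5] := coord_sum p.
rewrite /in_cone /log_ratio !cE.
have x_range x : e / 4 <= x -> x <= e / 2 ->
    - ln e <= ln (coord 2 p) - ln x /\ ln (coord 2 p) - ln x <= - ln e + 3.
  move=> xl xu; split.
    have := @log_sub_scale_ge e x (coord 2 p) 1 e0; rewrite subrr subr0; apply; try lra; nra.
  have := @log_sub_scale_le e (coord 2 p) x 4 e0 => h.
  have {h}: ln (coord 2 p) - ln x <= - ln e + (4 - 1) by apply: h; try lra; nra.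
  lra.
have [u1 u2] : - ln e <= ln (coord 2 p) - ln (coord 1 p) /\
   ln (coord 2 p) - ln (coord 1 p) <= - ln e + 3 by exact: x_range.
have [v1 v2] : - ln e <= ln (coord 2 p) - ln (coord 0 p) /\
   ln (coord 2 p) - ln (coord 0 p) <= - ln e + 3 by exact: x_range.
have w1 : - ln e - (2 - 1) <= ln (coord 5 p) - ln (coord 4 p).
  by apply: log_sub_scale_ge => //; try lra; nra.
have w2 : ln (coord 5 p) - ln (coord 4 p) <= - ln e + (4 - 1).
  by apply: log_sub_scale_le => //; try lra; nra.
have z1 : ln (coord 3 p) - ln (coord 5 p) <= 2 - 1 by apply: log_sub_le; lra.
have z2 : ln (coord 5 p) - ln (coord 3 p) <= 2 - 1 by apply: log_sub_le; lra.
split; [lra| | |]; apply/andP; split; lra.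
Qed.

End Boxes.

(** * Behaviour of the cycles *)

Section Behaviours.
Context {R : realType}.
Implicit Types (p q : state R) (b : bool) (k s : R).

Lemma leave_box_near (e : R) p : 0 < e <= 1 / 10 -> leave_box e p -> near_cycle e p.
Proof.
move=> /andP[e0 e1] /leave_boxP[/andP[? ?] /andP[? ?] /andP[? ?] /andP[? ?]].
apply/(has_nthP (0, 0, 0)); exists 0%N => //=.
by apply/and3P; split; lra.
Qed.

Lemma log_sub_le_small (m x y : R) : 0 < x -> x <= expR m / 4 -> 1 / 4 <= y ->
  ln x - ln y <= m.
Proof.
move=> x0 xm y4; have y0 : 0 < y by lra.
rewrite lerBlDr -[X in X + _](expRK m) -lnM ?posrE ?expR_gt0 //.
rewrite ler_ln ?posrE ?mulr_gt0 ?expR_gt0 // (le_trans xm) //.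
by rewrite ler_pM2l ?expR_gt0 //; lra.
Qed.

Lemma leave_box_start (e m : R) (c : nat -> R -> R) p : 0 < e <= 1 / 10 ->
  e <= expR m / 2 -> leave_box e p -> (forall i, c i 0 = coord i p) ->
  [/\ - 2 <= log_ratio (c 1) (c 2) 0, log_ratio (c 0) (c 2) 0 <= m,
      log_ratio (c 4) (c 5) 0 <= m, log_ratio (c 3) (c 5) 0 <= m &
      - 2 <= log_ratio (c 3) (c 4) 0].
Proof.
move=> /andP[e0 e1] em /leave_boxP[/andP[? ?] /andP[? ?] /andP[? ?] /andP[? ?]] cE.
have [E2 E5] := coord_sum p; rewrite /log_ratio !cE.
have flip (x y : R) : ln y - ln x <= 2 - 1 -> - 2 <= ln x - ln y by move=> ?; lra.
split; try by [apply: log_sub_le_small; lra | apply: flip; apply: log_sub_le; lra].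
Qed.

Section Behaviour.
Variables (b : bool) (e f : R) (phi : R -> state R -> state R).
Hypothesis ef : admissible e f.
Hypothesis phi0 : forall p, Delta p -> phi 0 p = p.
Hypothesis phiD : forall p, Delta p -> forall t, Delta (phi t p).
Let c p i t := coord i (relabel b (phi t p)).
Hypothesis orbit : forall p, Delta p -> positive_state (relabel b p) ->
  rsp_orbit e f (c p 0%N) (c p 1%N) (c p 2%N) (c p 3%N) (c p 4%N) (c p 5%N).

Let c0 p : Delta p -> forall i, c p i 0 = coord i (relabel b p).
Proof. by move=> Dp i; rewrite /c phi0. Qed.

Lemma stay_box_near L : \forall r \near 0^'+, forall p, stay_box r (relabel b p) ->
  Delta p /\ rsp_orbit e f (c p 0%N) (c p 1%N) (c p 2%N) (c p 3%N) (c p 4%N) (c p 5%N) /\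
  in_cone L (c p 0%N) (c p 1%N) (c p 2%N) (c p 3%N) (c p 4%N) (c p 5%N) 0.
Proof.
near=> r.
have r0 : 0 < r by near: r; exact: nbhs_right_gt.
have r1 : r <= 1 / 10 by near: r; apply: nbhs_right_le; lra.
have small (M : R) : r <= expR (- M) -> M <= - ln r.
  by move=> h; rewrite lerNr -[- M]expRK ler_ln ?posrE ?expR_gt0.
have r10 : 10 <= - ln r.
  by apply: small; near: r; apply: nbhs_right_le; exact: expR_gt0.
have rL : L <= - ln r.
  by apply: small; near: r; apply: nbhs_right_le; exact: expR_gt0.
move=> p Bp; have he : 0 < r <= 1 / 10 by rewrite r0.
have [/Delta_relabel Dp Ip] := stay_box_Delta he Bp.
split=> //; split; first exact: orbit.
by apply: stay_box_cone he r10 rL Bp _; exact: c0.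
Unshelve. all: by end_near. Qed.

(** Any neighbourhood contains the orbits of the points of the small stay
    boxes, and one of these points belongs to N. *)
Lemma not_almost_completely_unstable :
  ~ almost_completely_unstable phi (cycle_choice b).
Proof.
move=> [N dens [U nU unstable]].
have [k k0 kU] := near_cycle_nbhd nU.
have [L L0 stays] := cone_stays ef k0.
near (0 : R)^'+ => r.
have [p Np Bp] : exists2 p, N p & stay_box r (relabel b p).
  by near: r; exact: full_density_meets_stay_box dens.
have box q : stay_box r (relabel b q) ->
    Delta q /\ rsp_orbit e f (c q 0%N) (c q 1%N) (c q 2%N) (c q 3%N) (c q 4%N) (c q 5%N) /\
    in_cone L (c q 0%N) (c q 1%N) (c q 2%N) (c q 3%N) (c q 4%N) (c q 5%N) 0.
  by move: q; near: r; exact: stay_box_near.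
have [Dp [orb C]] := box p Bp.
have inU t : 0 <= t -> U (phi t p).
  by move=> t0; apply: kU; [exact: phiD|exact: (stays _ _ _ _ _ _ orb 0 (lexx _) C t t0)].
have [|t0 t00] := unstable p; last by apply; apply: inU; exact: ltW.
by split=> //; rewrite -(phi0 Dp); exact: inU.
Unshelve. all: by end_near. Qed.

Lemma attracts_open_set_cycle : attracts_open_set phi (cycle_choice b).
Proof.
have [L L0 attracted] := cone_attracted ef.
near (0 : R)^'+ => r.
have r0 : 0 < r by near: r; exact: nbhs_right_gt.
have box p : stay_box r (relabel b p) ->
    Delta p /\ rsp_orbit e f (c p 0%N) (c p 1%N) (c p 2%N) (c p 3%N) (c p 4%N) (c p 5%N) /\
    in_cone L (c p 0%N) (c p 1%N) (c p 2%N) (c p 3%N) (c p 4%N) (c p 5%N) 0.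
  by move: p; near: r; exact: stay_box_near.
pose slab i (l u : R) := ~` [set p | coord (swap_coord b i) p <= l] `&`
  ~` [set p : state R | u <= coord (swap_coord b i) p].
pose W := slab 0%N (r / 4) (r / 2) `&` slab 1%N (r / 4) (r / 2) `&`
  slab 3%N (2 / 5) (3 / 5) `&` slab 4%N (r / 4) (r / 2).
have WB p : W p -> stay_box r (relabel b p).
  have slabE i l u : slab i l u p -> l <= coord i (relabel b p) <= u.
    by rewrite coord_relabel => -[/negP h1 /negP h2]; rewrite !ltW // ltNge.
  by move=> [[[/slabE ? /slabE ?] /slabE ?] /slabE ?]; apply/stay_boxP.
exists (W `&` Delta); split.
- exists W => //; rewrite /W /slab.
  by do 4?[apply: openI]; rewrite openC;
    first [exact: closed_coord_le | exact: closed_coord_ge].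
- pose q : state R := relabel b (3 / 8 * r, 3 / 8 * r, 1 / 2, 3 / 8 * r).
  have Wq : W q.
    have slabq i l u : l < coord i (relabel b q) < u -> slab i l u q.
      by rewrite coord_relabel => /andP[? ?]; split; apply/negP; rewrite -ltNge.
    by split; [split; [split|]|]; apply: slabq; rewrite /q relabelK /coord /=; lra.
  by exists q; split=> //; case: (box q (WB q Wq)).
- move=> p [Wp _]; have [Dp [orb C]] := box p (WB p Wp).
  apply: omega_limit_near; first exact: phiD.
  by move=> k k0; exact: (attracted _ _ _ _ _ _ orb 0 (lexx _) C k k0).
Unshelve. all: by end_near. Qed.

(** The closed set F is disjoint from the cycle, and the orbits of the points
    of all small leave boxes enter it. *)
Lemma not_essentially_asymptotically_stable :
  ~ essentially_asymptotically_stable phi (cycle_choice b).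
Proof.
move=> [N dens stable].
have [m [k k0 esc]] := escape ef.
pose F := [set p | k <= coord (swap_coord b 3) p] `&`
  ([set p | 1 / 4 <= coord (swap_coord b 5) p] `&`
   [set p : state R | coord (swap_coord b 2) p <= 1 / 2]).
have FC : closed F.
  by do 2?[apply: closedI]; [exact: closed_coord_ge|exact: closed_coord_ge|exact: closed_coord_le].
have nU : nbhd (cycle_choice b) (~` F `&` Delta).
  exists (~` F) => // q /cycle_choiceP[Dq nq].
  apply: open_nbhs_nbhs; split; first by rewrite openC.
  rewrite /F /= -!coord_relabel => -[F1 [F2 F3]].
  have [E2 E5] := coord_sum (relabel b q).
  move: nq => /(has_nthP (0, 0, 0))[i i6].
  by case: i i6 => [|[|[|[|[|[|//]]]]]] _ /= /and3P[? ? ?]; lra.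
have [V nV stableV] := stable _ nU.
have [k' k'0 kV] := near_cycle_nbhd nV.
near (0 : R)^'+ => r.
have r0 : 0 < r by near: r; exact: nbhs_right_gt.
have r1 : r <= 1 / 10 by near: r; apply: nbhs_right_le; lra.
have rk : r <= k' by near: r; exact: nbhs_right_le.
have rm : r <= expR m / 2 by near: r; apply: nbhs_right_le; rewrite divr_gt0 ?expR_gt0.
have [p Np Bp] : exists2 p, N p & leave_box r (relabel b p).
  by near: r; exact: full_density_meets_leave_box dens.
have he : 0 < r <= 1 / 10 by rewrite r0.
have [/Delta_relabel Dp Ip] := leave_box_Delta he Bp.
have orb := orbit Dp Ip.
have Vp : V p.
  by apply: kV => //; apply: near_cycleW rk _; exact: leave_box_near he Bp.
have [_ stay] := stableV p (conj Vp Np).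
have [h1 h2 h3 h4 h5] := leave_box_start he rm Bp (c0 Dp).
have [T T0 [T1 T2 T3]] := esc _ _ _ _ _ _ orb h1 h2 h3 h4 h5.
have [[nF _] _] := stay T T0; apply: nF.
by rewrite /F /= -!coord_relabel.
Unshelve. all: by end_near. Qed.

End Behaviour.

(** For C2 the first player of the orbit lemmas is the second player of the
    game, so the two parameters are exchanged. *)
Lemma cycle_behaviour b (e f : R) phi : admissible e f ->
  rsp_flow (if b then f else e) (if b then e else f) phi ->
  [/\ ~ almost_completely_unstable phi (cycle_choice b),
      ~ essentially_asymptotically_stable phi (cycle_choice b) &
      attracts_open_set phi (cycle_choice b)].
Proof.
move=> ef flow.
have phi0 p : Delta p -> phi 0 p = p by move=> /flow[].
have phiD p : Delta p -> forall t, Delta (phi t p).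
  by move=> /flow[_ h] t; case: (h t).
have [/andP[e1 e2] /andP[f1 f2]] := ef.
have eb : -1 < e < 1 by apply/andP; split; lra.
have fb : -1 < f < 1 by apply/andP; split; lra.
pose c p i t := coord i (relabel b (phi t p)).
have orbit p : Delta p -> positive_state (relabel b p) ->
    rsp_orbit e f (c p 0%N) (c p 1%N) (c p 2%N) (c p 3%N) (c p 4%N) (c p 5%N).
  move=> Dp; rewrite /c; case: b flow {c} => flow Ip; last exact: flow_orbit flow Dp Ip.
  have Ip' : positive_state p by case: Ip.
  by have [? ?] := flow_orbit fb eb flow Dp Ip'.
split.
- exact: not_almost_completely_unstable orbit.
- exact: not_essentially_asymptotically_stable orbit.
- exact: attracts_open_set_cycle orbit.
Qed.

Lemma open_setX (A B : set R) : open A -> open B -> open (A `*` B).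
Proof.
rewrite !openE => oA oB [x y] [/= Ax By]; exists (A, B) => //.
by split; [exact: oA|exact: oB].
Qed.

Lemma open_admissible : open [set q : R * R | admissible q.1 q.2] /\
  open [set q : R * R | admissible q.2 q.1].
Proof.
have -> : [set q : R * R | admissible q.1 q.2] =
  `]1 / 2 - th / 2, 1 / 2 + th / 2[ `*` `]1 - th / 2, 1[.
  by apply/seteqP; split=> -[x y] /=; rewrite /admissible !in_itv.
have -> : [set q : R * R | admissible q.2 q.1] =
  `]1 - th / 2, 1[ `*` `]1 / 2 - th / 2, 1 / 2 + th / 2[.
  by apply/seteqP; split=> -[x y] /=; rewrite /admissible !in_itv => -[].
by split; apply: open_setX; exact: interval_open.
Qed.

End Behaviours.

Theorem theorem2 (R : realType) :
  exists O1 O2 : set (R * R),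
    [/\ open O1, O1 !=set0 & O1 `<=` unequal_params] /\
    [/\ open O2, O2 !=set0 & O2 `<=` unequal_params] /\
    (forall (eX eY : R) (phi : R -> state R -> state R),
       O1 (eX, eY) -> rsp_flow eX eY phi ->
       [/\ ~ almost_completely_unstable phi C1,
           ~ essentially_asymptotically_stable phi C1 &
           attracts_open_set phi C1]) /\
    (forall (eX eY : R) (phi : R -> state R -> state R),
       O2 (eX, eY) -> rsp_flow eX eY phi ->
       [/\ ~ almost_completely_unstable phi C2,
           ~ essentially_asymptotically_stable phi C2 &
           attracts_open_set phi C2]).
Proof.
pose O1 := [set q : R * R | admissible q.1 q.2].
have [open1 open2] := @open_admissible R.
have unequal q : O1 q -> [/\ -1 < q.1 < 1, -1 < q.2 < 1 & q.1 < q.2].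
  by move=> [/andP[? ?] /andP[? ?]]; split; lra.
have O1_point : O1 (1 / 2, 1 - th / 4) by rewrite /O1 /admissible /=; lra.
exists O1, [set q | O1 (q.2, q.1)]; split; [|split; [|split]].
- split=> //; first by exists (1 / 2, 1 - th / 4).
  by move=> q /unequal[? ? h]; split=> //; rewrite lt_eqF.
- split.
  + exact: open2.
  + by exists (1 - th / 4, 1 / 2).
  + by move=> q /unequal[? ? h]; split=> //; rewrite gt_eqF.
- by move=> eX eY phi ef flow; exact: (@cycle_behaviour R false eX eY).
- by move=> eX eY phi ef flow; exact: (@cycle_behaviour R true eY eX).
Qed.
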